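(* Fix $\kappa > \kappa^*$. Let $\alpha = \kappa 2^k\log k/k$ and $m=\lfloor \alpha n\rfloor$. There exists $k^*=k^*(\kappa)>0$ such that for any $k\ge k^*$ there exist $\eta=\Omega_k(k^{-2})$ (depending on $\kappa,k$) and $\nu=\frac{1}{k^22^k}$ such that the following holds. For all $r\in\mathbb N$ there exists $n^*>0$ (depending on $\kappa,k,r$) such that if $n\ge n^*$, then for any $r$-local algorithm $\mathcal A$ with output in $\{\mathtt T,\mathtt F\}^n$, \[ \mathbb P[\mathcal A(\Phi) \text{ } (\eta,\nu)\text{-satisfies } \Phi] \le \exp(-\widetilde\Omega(n^{1/3})), \] where the probability is over $\Phi\sim\Phi_k(n,m)$ and the independent internal randomness of $\mathcal A$.
   Context: Random $k$-SAT: literals $\mathcal{L}=\{x_1,\dots,x_n,\bar x_1,\dots,\bar x_n\}$; $\Omega_k(n,m)$ = ordered $m$-tuples of clauses, each an ordered $k$-tuple of literals; $\Phi_k(n,m)$ = uniform on $\Omega_k(n,m)$ (i.i.d. uniform literals). $x\in\{\mathtt T,\mathtt F\}^n$ $\nu$-satisfies $\Phi$ if it satisfies at least $(1-\nu)m$ clauses; $x$ $(\eta,\nu)$-satisfies $\Phi$ if some $y\in\{\mathtt T,\mathtt F\}^n$ with normalized Hamming distance $\Delta(x,y)\le\eta$ $\nu$-satisfies $\Phi$. $\iota(\beta)=\beta/(1-\beta e^{-(\beta-1)})$ on $(1,\infty)$, $\kappa^*=\min\iota\approx4.911$. Factor graph of $\Phi$: bipartite graph $G$ with variable vertices $v_1,\dots,v_n$,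 clause vertices $c_1,\dots,c_m$, an edge $(v_j,c_i)$ for each occurrence of $x_j$ or $\bar x_j$ in clause $i$, and polarity $\rho(e)=\mathtt T$ for $x_j$, $\mathtt F$ for $\bar x_j$. A decorated bipartite graph is $(G,\rho,\varphi)$ with $\rho:E_G\to\{\mathtt T,\mathtt F\}$, $\varphi:V_G\cup E_G\to\Omega$ for a probability space $(\Omega,\mathbb P_\omega)$; rooted if a vertex $v$ is marked. The $r$-neighborhood $N_r(v,G,\rho,\varphi)$ is the subgraph of vertices reachable from $v$ by paths of length $\le r$ and edges on those paths, with restricted decorations and root $v$. A function $f$ on rooted decorated bipartite graphs is $r$-local if $f(v,G,\rho,\varphi)$ depends only on the isomorphism class (preserving root, vertex sides, edges, $\rho,\varphi$) of $N_r(v,G,\rho,\varphi)$. The $r$-local algorithm based on an $r$-local $f$ with codomain $\{\mathtt T,\mathtt F\}$: on input $\Phi$ with factor graph $(G,\rho)$, sample $\varphi\sim(\Omega,\mathbb P_\omega)^{\otimes(V_G\cup E_G)}$ independently of $\Phi$ and output $x_i=f(v_i,G,\rho,\varphi)$. Notation: $\widetilde\Omega(n^{1/3})$ means at least $c\,n^{1/3}/\mathrm{polylog}(n)$ for some $c>0$ that may depend on $\kappa,k,r$; $\Omega_k(k^{-2})$ means a quantity independent of $n$ at least $c/k^2$ for a constant $c>0$. *)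

(* Defs.v *)
From HB Require Import structures.
From mathcomp Require Import all_boot all_order all_algebra.
From mathcomp Require Import all_classical all_reals all_analysis.

Set Implicit Arguments.
Unset Strict Implicit.
Unset Printing Implicit Defensive.

Import Order.TTheory GRing.Theory Num.Theory.
Import numFieldNormedType.Exports.

Local Open Scope classical_set_scope.
Local Open Scope ring_scope.

(* [(j, true)] is the literal x_j and [(j, false)] its negation; variables are
   numbered from 0. *)
Definition literal (n : nat) := ('I_n * bool)%type.
Definition clause (k n : nat) := k.-tuple (literal n).
Definition formula (k n m : nat) := m.-tuple (clause k n).
Definition assignment (n : nat) := {ffun 'I_n -> bool}.

Definition clause_sat (k n : nat) (x : assignment n) (c : clause k n) : bool :=
  [exists a : 'I_k, x (tnth c a).1 == (tnth c a).2].

Section Satisfaction.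
Variables (R : realType) (k n m : nat).
Implicit Types (x y : assignment n) (Phi : formula k n m).

Definition nu_satisfies (nu : R) x Phi : Prop :=
  (1 - nu) * m%:R <= #|[pred i : 'I_m | clause_sat x (tnth Phi i)]|%:R.

Definition hamming x y : R := #|[pred j : 'I_n | x j != y j]|%:R / n%:R.

Definition eta_nu_satisfies (eta nu : R) x Phi : Prop :=
  exists2 y : assignment n, hamming x y <= eta & nu_satisfies nu y Phi.

End Satisfaction.

Definition iota_fun (R : realType) (b : R) : R :=
  b / (1 - b * expR (- (b - 1))).

(* [iota_fun] is continuous and positive on (1, +oo) and tends to +oo at both
   ends, so this infimum is attained. *)
Definition kappa_star (R : realType) : R :=
  inf [set iota_fun b | b in [set b : R | 1 < b]].

(* Edges form a type of their own: a factor graph can have parallel edges. *)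
Record bip_graph := BipGraph {
  vside : Type;
  cside : Type;
  edge : Type;
  vend : edge -> vside;
  cend : edge -> cside }.

Definition vertex (G : bip_graph) := (vside G + cside G)%type.

Record decorated (Omega : Type) := Decorated {
  dec_graph :> bip_graph;
  polarity : edge dec_graph -> bool;
  deco : vertex dec_graph + edge dec_graph -> Omega }.

Record rooted (Omega : Type) := Rooted {
  root_graph :> decorated Omega;
  root : vertex root_graph }.

Definition joins (G : bip_graph) (e : edge G) (u w : vertex G) : Prop :=
  (u = inl (vend e) /\ w = inr (cend e)) \/
  (u = inr (cend e) /\ w = inl (vend e)).

Fixpoint walk (G : bip_graph) (u : vertex G) (p : seq (edge G)) (z : vertex G) :
    Prop :=
  match p with
  | [::] => u = z
  | e :: p' => exists2 w, joins e u w & walk w p' z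
  end.

(* Walks may repeat vertices, but in a bipartite graph this changes neither the
   vertices nor the edges met within distance r: the distances to v of the two
   ends of an edge differ by exactly 1, so a shortest path to the nearer end
   followed by that edge has no repeated vertex. *)
Definition near_vertex (G : bip_graph) (r : nat) (v u : vertex G) : Prop :=
  exists2 p, walk v p u & (size p <= r)%N.

Definition near_edge (G : bip_graph) (r : nat) (v : vertex G) (e : edge G) :
    Prop :=
  exists p q u, walk v (p ++ e :: q) u /\ (size (p ++ e :: q) <= r)%N.

Lemma walk_cat (G : bip_graph) p q (v u : vertex G) :
  walk v (p ++ q) u <-> exists2 w, walk v p w & walk w q u.
Proof.
elim: p v => [|e p IH] v /=; first by split=> [h|[w ->]//]; exists v.
split=> [[y J /IH[w W1 W2]]|[w [y J W1] W2]]; last first.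
  by exists y => //; apply/IH; exists w.
by exists w => //; exists y.
Qed.

Lemma near_edge_ends (G : bip_graph) r (v : vertex G) (e : edge G) :
  near_edge r v e ->
  near_vertex r v (inl (vend e)) /\ near_vertex r v (inr (cend e)).
Proof.
move=> [p [q [u [/walk_cat[w W1 [y J _]]]]]]; rewrite size_cat /= => sz.
have sp : (size p <= r)%N by apply: leq_trans sz; rewrite leq_addr.
have spe : (size (p ++ [:: e]) <= r)%N.
  by apply: leq_trans sz; rewrite size_cat leq_add2l.
have W2 : walk v (p ++ [:: e]) y by apply/walk_cat; exists w => //; exists y.
case: J W1 W2 => -[-> ->] W1 W2; split;
  by [exists p | exists (p ++ [:: e])].
Qed.

Section Neighborhood.
Variables (Omega : Type) (r : nat) (G : rooted Omega).

Definition nbhd_vside := {x : vside G | near_vertex r (root G) (inl x)}.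
Definition nbhd_cside := {c : cside G | near_vertex r (root G) (inr c)}.
Definition nbhd_edge := {e : edge G | near_edge r (root G) e}.

Definition nbhd_graph : bip_graph :=
  @BipGraph nbhd_vside nbhd_cside nbhd_edge
    (fun e => exist _ (vend (sval e)) (near_edge_ends (svalP e)).1)
    (fun e => exist _ (cend (sval e)) (near_edge_ends (svalP e)).2).

Definition nbhd_incl (s : vertex nbhd_graph + edge nbhd_graph) :
    vertex G + edge G :=
  match s with
  | inl (inl x) => inl (inl (sval x))
  | inl (inr c) => inl (inr (sval c))
  | inr e => inr (sval e)
  end.

Definition nbhd_decorated : decorated Omega :=
  @Decorated Omega nbhd_graph
    (fun e => polarity (sval e)) (fun s => deco (nbhd_incl s)).

Definition nbhd_root : vertex nbhd_decorated :=
  match root G as v return near_vertex r (root G) v -> vertex nbhd_decorated with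
  | inl x => fun h => inl (exist _ x h)
  | inr c => fun h => inr (exist _ c h)
  end (ex_intro2 _ _ [::] (erefl (root G)) (leq0n r)).

Definition nbhd : rooted Omega := @Rooted Omega nbhd_decorated nbhd_root.

End Neighborhood.

Definition map_vertex (G H : bip_graph) (hv : vside G -> vside H)
    (hc : cside G -> cside H) (u : vertex G) : vertex H :=
  match u with inl x => inl (hv x) | inr c => inr (hc c) end.

Definition isomorphic (Omega : Type) (G H : rooted Omega) : Prop :=
  exists (hv : vside G -> vside H) (hc : cside G -> cside H)
         (he : edge G -> edge H),
    [/\ bijective hv, bijective hc & bijective he] /\
    [/\ forall e, vend (he e) = hv (vend e),
        forall e, cend (he e) = hc (cend e) &
        map_vertex hv hc (root G) = root H] /\
    [/\ forall e, polarity (he e) = polarity e,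
        forall u : vertex G,
          deco (inl (map_vertex hv hc u)) = deco (inl u) &
        forall e : edge G, deco (inr (he e)) = deco (inr e)].

Definition r_local (Omega T : Type) (r : nat) (f : rooted Omega -> T) : Prop :=
  forall G H : rooted Omega, isomorphic (nbhd r G) (nbhd r H) -> f G = f H.

(* The edge [(i, a)] is the a-th literal occurrence in clause i. *)
Definition factor_graph (k n m : nat) (Phi : formula k n m) : bip_graph :=
  @BipGraph 'I_n 'I_m ('I_m * 'I_k)%type
    (fun e => (tnth (tnth Phi e.1) e.2).1) (fun e => e.1).

(* The index set V_G + E_G of the internal randomness; it does not depend on
   the formula. *)
Definition site (k n m : nat) := (('I_n + 'I_m) + ('I_m * 'I_k))%type.

Definition decorated_factor_graph (k n m : nat) (Omega : Type)
    (Phi : formula k n m) (phi : site k n m -> Omega) : decorated Omega :=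
  @Decorated Omega (factor_graph Phi)
    (fun e : 'I_m * 'I_k => (tnth (tnth Phi e.1) e.2).2) phi.

Section LocalAlgorithm.
Context (d : measure_display) (Omega : measurableType d) (k n m : nat).

(* A sample of the internal randomness, as a tuple indexed by an enumeration of
   the sites: the library's product sigma-algebra is on tuples. *)
Definition sample := #|{: site k n m}|.-tuple Omega.

Definition sample_at (t : sample) (s : site k n m) : Omega :=
  tnth t (enum_rank s).

Definition local_alg (f : rooted Omega -> bool) (Phi : formula k n m)
    (t : sample) : assignment n :=
  [ffun j => f (@Rooted Omega (decorated_factor_graph Phi (sample_at t))
                  (inl j))].

(* Implicit in calling the output random: for each fixed input, every output
   bit is a measurable function of the internal randomness. *)
Definition measurable_alg (f : rooted Omega -> bool) : Prop :=
  forall (Phi : formula k n m) (j : 'I_n),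
    measurable_fun [set: sample] (fun t : sample => local_alg f Phi t j).

End LocalAlgorithm.

Section PowerProbability.
Context (d : measure_display) (T : measurableType d) (R : realType)
        (P : probability T R).

Definition tcons (N : nat) (x : T * N.-tuple T) : N.+1.-tuple T :=
  [the N.+1.-tuple T of x.1 :: x.2].

Lemma measurable_tcons N : measurable_fun [set: T * N.-tuple T] (@tcons N).
Proof. by apply: measurable_cons. Qed.

HB.instance Definition _ N := @isMeasurableFun.Build _ _ (T * N.-tuple T)%type
  (N.+1.-tuple T) (@tcons N) (@measurable_tcons N).

Fixpoint power_prob (N : nat) : probability (N.-tuple T) R :=
  match N with
  | 0 => \d_([tuple] : 0.-tuple T)
  | N'.+1 => distribution (P \x power_prob N')%E (@tcons N')
  end.

Lemma measurable_box N (A : 'I_N -> set T) : (forall i, measurable (A i)) ->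
  measurable [set t : N.-tuple T | forall i, A i (tnth t i)].
Proof.
move=> mA.
rewrite (_ : [set _ | _] =
  \bigcap_(i in [set: 'I_N]) ((fun t : N.-tuple T => tnth t i) @^-1` A i)).
  apply: fin_bigcap_measurable => // i _; rewrite -[X in measurable X]setTI.
  exact: measurable_tnth.
by apply/seteqP; split=> t /= h i; [move=> _; exact: h | exact: (h i)].
Qed.

Lemma power_prob_box N (A : 'I_N -> set T) : (forall i, measurable (A i)) ->
  power_prob N [set t | forall i, A i (tnth t i)] = (\prod_(i < N) P (A i))%E.
Proof.
elim: N A => [|N IH] A mA.
  rewrite big_ord0 /= diracE mem_set//= => -[].
  by [].
rewrite big_ord_recl -IH// /= /distribution /pushforward /=.
rewrite -product_measure1E//; last first.
  by apply: (@measurable_box N (fun i => A (lift ord0 i))) => i; exact: mA.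
congr (_ _); apply/seteqP; split=> -[x t] /= h.
  split; first exact: (h ord0).
  by move=> i; have := h (lift ord0 i); rewrite tnthS.
case: h => h0 h i; case: (unliftP ord0 i) => [j|] ->; last exact: h0.
by rewrite tnthS; exact: h.
Qed.

End PowerProbability.

(* The probability that [local_alg f] (eta, nu)-satisfies a uniform formula,
   formula and internal randomness being independent. *)
Definition success_prob (d : measure_display) (Omega : measurableType d)
    (R : realType) (P : probability Omega R) (k n m : nat)
    (f : rooted Omega -> bool) (eta nu : R) : \bar R :=
  ((#|{: formula k n m}|%:R^-1)%:E *
   \sum_(Phi : formula k n m)
     power_prob P #|{: site k n m}|
       [set t | eta_nu_satisfies eta nu (local_alg f Phi t) Phi])%E.

(* Main.v *)
Require Import Defs.
From mathcomp Require Import all_boot all_order all_algebra.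
From mathcomp Require Import all_classical all_reals all_analysis.
From mathcomp Require Import measurable_realfun.
From mathcomp Require Import ring lra zify.

Set Implicit Arguments.
Unset Strict Implicit.
Unset Printing Implicit Defensive.

Import Order.TTheory GRing.Theory Num.Theory.
Import numFieldNormedType.Exports.

Local Open Scope ring_scope.

(* The ensemble overlap gap argument, run directly on local algorithms; it gives
   a failure probability exp(- Omega(n)).

   Fixing the internal randomness makes the algorithm a deterministic map x of
   the formula. Give every clause slot k + 1 independent clauses, cut the m slots
   into a bounded number M of blocks, and let a time t select in every block one
   of the versions, so that consecutive times differ in one small block and times
   M apart have no clause in common. By Jensen's inequality, applied once per
   block, if x succeeds with probability p then it succeeds on all combinations
   of versions at once with probability at least p^((k + 1)^M). Outside of events
   of probability exp(- Omega(n)):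
   - no small set of clauses is within distance r of many variables, so locality
     makes x, hence the nearby solution y(t), move slowly in t;
   - no solution for fresh clauses has small conditional empirical entropy given
     solutions for earlier, independent clauses;
   - there is no sequence y_0, ..., y_k of solutions at times t_0, ..., t_k in
     which each H(y_l | y_0 ... y_(l-1)) lies in a window around b ln k / k. Given
     the entropies, a clause violated by y_l is violated by an earlier y_j with
     probability at most about b e^(1 - b), so the first moment is exponentially
     small as soon as b < kappa (1 - b e^(1 - b)), i.e. iota b < kappa.
   The first two properties and a discrete continuity argument produce a sequence
   forbidden by the third, so p is exponentially small. *)

(** * Averages over finite types, conditional empirical entropy *)

Section Average.
Variable R : realType.
Implicit Types T S J : finType.

(** Probabilities over uniform finite objects are written as averages of 0/1 indicators. On an empty
    type the value is 0, which is why [avg_cst] asks for a point. *)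
Definition avg T (F : T -> R) : R := (\sum_x F x) / #|T|%:R.

Lemma le_avg T (F G : T -> R) : (forall x, F x <= G x) -> avg F <= avg G.
Proof. by move=> FG; rewrite /avg ler_wpM2r ?invr_ge0 ?ler0n// ler_sum. Qed.

Lemma eq_avg T (F G : T -> R) : F =1 G -> avg F = avg G.
Proof. by move=> FG; rewrite /avg (eq_bigr G). Qed.

Lemma avg_ge0 T (F : T -> R) : (forall x, 0 <= F x) -> 0 <= avg F.
Proof. by move=> F0; rewrite /avg divr_ge0 ?ler0n ?sumr_ge0. Qed.

Lemma avgZ T (c : R) (F : T -> R) : avg (fun x => c * F x) = c * avg F.
Proof. by rewrite /avg -mulr_sumr mulrA. Qed.

Lemma avgD T (F G : T -> R) : avg (fun x => F x + G x) = avg F + avg G.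
Proof. by rewrite /avg big_split mulrDl. Qed.

Lemma avgB T (F G : T -> R) : avg (fun x => F x - G x) = avg F - avg G.
Proof. by rewrite /avg sumrB mulrBl. Qed.

Lemma avg_sum T (I : Type) (s : seq I) (P : pred I) (F : I -> T -> R) :
  avg (fun x => \sum_(i <- s | P i) F i x) = \sum_(i <- s | P i) avg (F i).
Proof. by rewrite /avg exchange_big/= mulr_suml. Qed.

Lemma avg_cst T (x0 : T) (c : R) : avg (fun _ : T => c) = c.
Proof.
rewrite /avg sumr_const -[c *+ _]mulr_natr mulfK// pnatr_eq0 -lt0n.
by apply/card_gt0P; exists x0.
Qed.

Lemma avg_reindex T S (h : S -> T) (F : T -> R) : bijective h ->
  avg F = avg (F \o h).
Proof.
by move=> bh; rewrite /avg (reindex h) ?(bij_eq_card bh)//; exact/onW_bij.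
Qed.

Lemma avg_pair T S (F : T -> S -> R) :
  avg (fun x => avg (F x)) = avg (fun p : T * S => F p.1 p.2).
Proof.
by rewrite /avg -mulr_suml -mulrA -invfM card_prod natrM pair_bigA/= mulrC
  (mulrC #|S|%:R) mulrC.
Qed.

(** The coordinates of a uniform function are independent: expand the product of sums. *)
Lemma avg_prod J T (g : J -> T -> R) :
  avg (fun U : {ffun J -> T} => \prod_j g j (U j)) = \prod_j avg (g j).
Proof.
rewrite /avg -bigA_distr_bigA/= card_ffun natrX big_split/=; congr (_ * _).
by rewrite prodr_const exprVn.
Qed.

Lemma avg_prod_le n T (F : T -> R) (c : R) : (forall i, 0 <= F i) ->
  avg F <= c -> avg (fun x : {ffun 'I_n -> T} => \prod_s F (x s)) <= c ^+ n.
Proof.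
move=> F0 Fc; rewrite (avg_prod (fun=> F)) prodr_const card_ord.
by rewrite lerXn2r ?nnegrE ?avg_ge0// (le_trans _ Fc) ?avg_ge0.
Qed.

Lemma avg_tuple T k (F : k.-tuple T -> R) :
  avg F = avg (fun f : {ffun 'I_k -> T} => F [tuple f i | i < k]).
Proof.
rewrite (@avg_reindex _ _ (fun f : {ffun 'I_k -> T} => [tuple f i | i < k]))//.
exists (fun t : k.-tuple T => [ffun i => tnth t i]).
  by move=> f; apply/ffunP=> i; rewrite ffunE tnth_mktuple.
by move=> t; apply: eq_from_tnth => i; rewrite tnth_mktuple ffunE.
Qed.

(** Convexity of the power. In the inductive step the gap is a nonnegative multiple of
    [(x - m) ^+ 2]. *)
Lemma expr_tangent (m x : R) n : 0 <= m -> 0 <= x ->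
  m ^+ n + n%:R * m ^+ n.-1 * (x - m) <= x ^+ n.
Proof.
move=> m0 x0; elim: n => [|n IH]; first by rewrite !expr0 mul0r mul0r addr0.
rewrite [x ^+ _]exprS; apply: (le_trans _ (ler_wpM2l x0 IH)); rewrite -subr_ge0.
case: n {IH} => [|n] /=; first by rewrite expr0 expr1; lra.
rewrite (_ : _ - _ = n.+1%:R * m ^+ n * (x - m) ^+ 2).
  by rewrite mulr_ge0 ?sqr_ge0// mulr_ge0 ?exprn_ge0.
by rewrite !exprS -!natr1; ring.
Qed.

(** Jensen's inequality: the linear term of the tangent at the mean averages to 0. *)
Lemma exp_avg_le T (x0 : T) (F : T -> R) n : (forall x, 0 <= F x) ->
  avg F ^+ n <= avg (fun x => F x ^+ n).
Proof.
move=> F0; have A0 := avg_ge0 F0; set m := avg F in A0 *.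
apply: le_trans (le_avg (fun x => expr_tangent n A0 (F0 x))) => //.
by rewrite avgD avg_cst// avgZ avgB avg_cst// subrr mulr0 addr0.
Qed.

Lemma avg_exists_le T S (A : S -> pred T) :
  avg (fun x => [exists i, A i x]%:R) <= \sum_i avg (fun x => (A i x)%:R).
Proof.
rewrite -avg_sum; apply: le_avg => x.
case: existsP => [[i Ai]|_]; last by rewrite sumr_ge0.
by rewrite (bigD1 i)//= Ai lerDl sumr_ge0.
Qed.

End Average.

Section Entropy.
Variables (R : realType) (I A : finType).
Implicit Types (a : I -> A) (y : I -> bool) (c : A) (b : bool).

Definition cell a c : nat := #|[pred i | a i == c]|.
Definition subcell a y c b : nat := #|[pred i | (a i == c) && (y i == b)]|.
Definition cprob a y c b : R := (subcell a y c b)%:R / (cell a c)%:R.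
Definition pprob a y (i : I) : R := cprob a y (a i) (y i).
(** Conditional entropy, in nats, of [y i] given [a i] for a uniform index i. Summing over indices
    rather than over cells keeps every logarithm at a positive argument. *)
Definition cond_ent a y : R := (\sum_i - ln (pprob a y i)) / #|I|%:R.

Lemma subcell_split a y c :
  (subcell a y c true + subcell a y c false)%N = cell a c.
Proof.
rewrite /cell -(cardID [pred i | y i]); congr (_ + _)%N; apply: eq_card => i.
  by rewrite !inE; case: (y i); rewrite ?andbT ?andbF.
by rewrite !inE; case: (y i); rewrite ?andbT ?andbF.
Qed.

Lemma subcell_le a y c b : (subcell a y c b <= cell a c)%N.
Proof. by rewrite -(subcell_split a y); case: b; rewrite ?leq_addl ?leq_addr. Qed.

Lemma subcell_gt0 a y i : (0 < subcell a y (a i) (y i))%N.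
Proof. by apply/card_gt0P; exists i; rewrite !inE !eqxx. Qed.

Lemma cell_gt0 a i : (0 < cell a (a i))%N.
Proof. by apply/card_gt0P; exists i; rewrite !inE !eqxx. Qed.

Lemma cprob_ge0 a y c b : 0 <= cprob a y c b.
Proof. by rewrite divr_ge0. Qed.

Lemma cprob_sum a y i :
  cprob a y (a i) true + cprob a y (a i) false = 1.
Proof.
rewrite -mulrDl -natrD subcell_split divff// pnatr_eq0 -lt0n; exact: cell_gt0.
Qed.

Lemma pprob_gt0 a y i : 0 < pprob a y i.
Proof. by rewrite divr_gt0 ?ltr0n ?subcell_gt0 ?cell_gt0. Qed.

Lemma pprob_le1 a y i : pprob a y i <= 1.
Proof.
rewrite ler_pdivrMr ?ltr0n ?cell_gt0// mul1r ler_nat; exact: subcell_le.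
Qed.

Lemma natr_card_sum (T : finType) (P : pred T) :
  #|P|%:R = \sum_i (P i)%:R :> R.
Proof.
rewrite -sum1_card big_mkcond natr_sum; apply: eq_bigr => i _.
by rewrite unfold_in; case: (P i).
Qed.

Lemma sum_pred_card (T : finType) (P : pred T) (x : R) :
  \sum_(i | P i) x = #|P|%:R * x.
Proof. by rewrite sumr_const mulr_natl. Qed.

(* Change of measure: averaging [w / p] against the empirical measure [p]
   gives at most the total mass of [w]. *)
Lemma sum_div_pprob a y (w : A -> bool -> R) : (forall c b, 0 <= w c b) ->
  \sum_i w (a i) (y i) / pprob a y i <= \sum_i (w (a i) true + w (a i) false).
Proof.
move=> w0; rewrite (partition_big a xpredT)//= [leRHS](partition_big a xpredT)//=.
apply: ler_sum => c _; rewrite [leRHS](_ : _ = \sum_b (cell a c)%:R * w c b).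
  rewrite (partition_big y xpredT)//=; apply: ler_sum => b _.
  rewrite (eq_bigr (fun=> w c b / cprob a y c b)); last first.
    by move=> i /andP[/eqP <- /eqP <-].
  rewrite sum_pred_card -/(subcell a y c b) /cprob invf_div.
  have [->|nz] := eqVneq (subcell a y c b) 0%N.
    by rewrite mul0r mulr_ge0.
  suff -> : (subcell a y c b)%:R * (w c b * ((cell a c)%:R / (subcell a y c b)%:R))
    = (cell a c)%:R * w c b by [].
  by field; rewrite pnatr_eq0.
rewrite big_bool/= -mulrDr (eq_bigr (fun=> w c true + w c false)).
  by rewrite sum_pred_card.
by move=> i /eqP ->.
Qed.

Lemma cond_ent_fun a y (g : A -> bool) : (forall i, y i = g (a i)) ->
  cond_ent a y = 0.
Proof.
move=> yg; rewrite /cond_ent big1 ?mul0r// => i _.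
rewrite (_ : pprob a y i = 1) ?ln1 ?oppr0// /pprob /cprob.
rewrite (_ : subcell _ _ _ _ = cell a (a i)).
  by rewrite divff// pnatr_eq0 -lt0n cell_gt0.
apply: eq_card => j; rewrite !inE andb_idr// => /eqP aij.
by rewrite !yg aij.
Qed.

(** Cross entropy dominates entropy: [ln u <= u - 1] is applied to [u = Q / pprob], whose sum is
    controlled by the change of measure. *)
Lemma gibbs a y (Q : A -> bool -> R) : (forall c b, 0 <= Q c b) ->
  (forall i, 0 < Q (a i) (y i)) ->
  (forall i, Q (a i) true + Q (a i) false <= 1) ->
  cond_ent a y <= (\sum_i - ln (Q (a i) (y i))) / #|I|%:R.
Proof.
move=> Q0 Qp Q1; rewrite ler_wpM2r ?invr_ge0// -subr_le0 -sumrB.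
under eq_bigr do rewrite opprK addrC.
apply: (@le_trans _ _ (\sum_i (Q (a i) (y i) / pprob a y i - 1))).
  apply: ler_sum => i _; rewrite -ln_div ?posrE ?pprob_gt0//.
  have q0 : 0 < Q (a i) (y i) / pprob a y i by rewrite divr_gt0 ?pprob_gt0.
  have := le_ln1Dx (x := Q (a i) (y i) / pprob a y i - 1).
  by rewrite addrCA subrr addr0; apply; rewrite ltrBrDr addNr.
rewrite sumrB subr_le0; apply: le_trans (sum_div_pprob a y Q0) _.
by apply: ler_sum => i _; exact: Q1.
Qed.

(* The flip noise [s] makes the reference measure of [y] charge every bit of
   [z], at the price [ln (1 / s)] per disagreement. *)
Lemma cond_ent_continuous a y z (s del : R) : (0 < #|I|)%N -> 0 < s < 1 ->
  #|[pred i | y i != z i]|%:R <= del * #|I|%:R ->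
  cond_ent a z <= cond_ent a y - ln (1 - s) - del * ln s.
Proof.
move=> I0 /andP[s0 s1] hd.
have s1' : 0 < 1 - s by rewrite subr_gt0.
pose Q c b := (1 - s) * cprob a y c b + s * cprob a y c (~~ b).
have Qlow i : (if y i == z i then 1 - s else s) * pprob a y i <= Q (a i) (z i).
  rewrite /pprob /Q; have c0 := cprob_ge0 a y (a i).
  case: (y i) (z i) => -[] /=; rewrite ?lerDl ?lerDr mulr_ge0//; exact: ltW.
have Qlow0 i : 0 < (if y i == z i then 1 - s else s) * pprob a y i.
  by rewrite mulr_gt0 ?pprob_gt0//; case: ifP.
have Qpos i : 0 < Q (a i) (z i) by exact: lt_le_trans (Qlow i).
apply: le_trans (@gibbs a z Q _ Qpos _) _.
- by move=> c b; rewrite addr_ge0// mulr_ge0 ?cprob_ge0// ltW.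
- move=> i; rewrite /Q /= -[leRHS](cprob_sum a y i); lra.
rewrite -addrA -opprD; have In0 : 0 < #|I|%:R :> R by rewrite ltr0n.
rewrite ler_pdivrMr// mulrBl divfK ?gt_eqF//.
apply: (@le_trans _ _ (\sum_i (- ln (pprob a y i) - ln (1 - s)
    - (y i != z i)%:R * ln s))).
  apply: ler_sum => i _.
  apply: (@le_trans _ _ (- ln ((if y i == z i then 1 - s else s) * pprob a y i))).
    by rewrite lerN2 ler_ln ?posrE.
  rewrite lnM ?posrE ?pprob_gt0//; last by case: ifP.
  case: ifP => _ /=; first by rewrite mul0r subr0 opprD addrC.
  rewrite mul1r opprD addrC lerD2r lerDl oppr_ge0 ln_le0//; lra.
rewrite !sumrB -!mulr_suml sum_pred_card -natr_card_sum.
have lns : ln s <= 0 by rewrite ln_le0// ltW.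
have := ler_wnM2r lns hd; rewrite mulrDl -subr_ge0 => h; rewrite -subr_ge0.
rewrite (_ : #|{: I}| = #|I|)//; lra.
Qed.

(** Method of types: the numbers of true bits in the cells determine a product measure of total mass
    1, under which every y with these counts has probability e^(- |I| H(y | a)). There are at most
    (|I| + 1)^|A| count vectors. *)
Lemma card_cond_ent_le a (h : R) : (0 < #|I|)%N ->
  #|[pred y : {ffun I -> bool} | cond_ent a y <= h]|%:R
    <= #|I|.+1%:R ^+ #|A| * expR (#|I|%:R * h).
Proof.
move=> I0; have In0 : 0 < #|I|%:R :> R by rewrite ltr0n.
(* The [minn] makes [Q q] a probability measure for every vector q, including those that are not the
   counts of any y. *)
pose Q (q : {ffun A -> 'I_#|I|.+1}) c b : R :=
  let x := (minn (q c) (cell a c))%:R / (cell a c)%:R in if b then x else 1 - x.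
have Qge0 q c b : 0 <= Q q c b.
  have [c0|c0] := posnP (cell a c).
    by rewrite /Q c0 invr0 mulr0; case: b => //; rewrite subr0.
  rewrite /Q; case: b; first by rewrite divr_ge0.
  by rewrite subr_ge0 ler_pdivrMr ?ltr0n// mul1r ler_nat geq_minr.
pose typ (y : {ffun I -> bool}) : {ffun A -> 'I_#|I|.+1} :=
  [ffun c => inord (subcell a y c true)].
have typE (y : {ffun I -> bool}) i : pprob a y i = Q (typ y) (a i) (y i).
  have yc : subcell a y (a i) true = minn (typ y (a i)) (cell a (a i)).
    rewrite ffunE inordK ?(minn_idPl (subcell_le _ _ _ _))//.
    by rewrite ltnS max_card.
  rewrite /Q -yc /pprob; case: (y i) => //.
  by have := cprob_sum a y i; rewrite /cprob; lra.
have entE (y : {ffun I -> bool}) :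
    expR (- (#|I|%:R * cond_ent a y)) = \prod_i Q (typ y) (a i) (y i).
  rewrite /cond_ent mulrC divfK ?gt_eqF// sumrN opprK.
  rewrite expR_sum; apply: eq_bigr => i _.
  by rewrite lnK ?posrE ?pprob_gt0.
rewrite natr_card_sum.
apply: (@le_trans _ _ (\sum_(y : {ffun I -> bool})
   expR (#|I|%:R * h) * \sum_q \prod_i Q q (a i) (y i))).
  apply: ler_sum => y _ /=.
  have S0 : 0 <= \sum_q \prod_i Q q (a i) (y i).
    by apply: sumr_ge0 => q _; apply: prodr_ge0.
  case: (boolP (_ <= h)) => hy; last by rewrite mulr_ge0 ?expR_ge0.
  apply: (@le_trans _ _ (expR (#|I|%:R * h) * expR (- (#|I|%:R * cond_ent a y)))).
    by rewrite -expRD -expR0 ler_expR subr_ge0 ler_wpM2l// ltW.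
  rewrite ler_wpM2l ?expR_ge0// entE (bigD1 (typ y))//= lerDl sumr_ge0// => q _.
  exact: prodr_ge0.
rewrite -mulr_sumr mulrC ler_wpM2r ?expR_ge0// exchange_big/=.
rewrite (eq_bigr (fun=> 1)) ?sumr_const ?card_ffun ?card_ord ?natrX// => q _.
rewrite -(bigA_distr_bigA (fun i b => Q q (a i) b)) big1// => i _.
by rewrite big_bool/= /Q addrC subrK.
Qed.

End Entropy.

(** Convexity: the tangent inequalities at u, evaluated at 0 and at [- lam], are combined with
    weights [1 - x] and x. *)
Lemma expR_chord (R : realType) (lam x : R) : 0 <= x <= 1 ->
  expR (- (lam * x)) <= 1 - (1 - expR (- lam)) * x.
Proof.
move=> /andP[x0 x1]; set u := - (lam * x).
have e0 : 0 <= expR u by exact: expR_ge0.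
have h1 : expR u * (1 - u) <= 1.
  rewrite [leRHS](_ : _ = expR u * expR (- u)) ?ler_wpM2l ?expR_ge1Dx//.
  by rewrite -expRD subrr expR0.
have h2 : expR u * (1 + (- lam - u)) <= expR (- lam).
  rewrite [leRHS](_ : _ = expR u * expR (- lam - u)) ?ler_wpM2l ?expR_ge1Dx//.
  by rewrite -expRD addrC subrK.
have x1' : 0 <= 1 - x by rewrite subr_ge0.
have := lerD (ler_wpM2l x1' h1) (ler_wpM2l x0 h2).
rewrite (_ : (1 - x) * _ + _ = expR u); last first.
  have u1 : 1 - u - lam * x = 1 by rewrite /u opprK addrK.
  by rewrite -[RHS]mulr1 -[X in _ = _ * X]u1; ring.
move=> h; apply: le_trans h _; lra.
Qed.

(** * Agreement with earlier assignments on a random tuple of variables *)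

Section Agreement.
Variables (R : realType) (I A : finType) (k : nat).

(** When y violates a clause on the variables x, this is the event that z violates it too. *)
Definition agrees (y z : I -> bool) (x : {ffun 'I_k -> I}) : bool :=
  [forall s, y (x s) == z (x s)].

(* With [J = - ln p], the word [y o x] has information [\sum_s J (x s)]. When it
   exceeds [T], each given word has probability at most [expR (- T)]; otherwise
   a sum of variables [J / T], of total mean about [k H / T], is at most [1]. *)
Lemma agrees_prob (a : I -> A) (y : I -> bool) (zs : seq {ffun I -> bool})
    (i0 : I) (T lam : R) : 0 < T -> 0 <= lam ->
  (forall z, z \in zs -> exists g : A -> bool, forall i, z i = g (a i)) ->
  avg (fun x => (has (fun z : {ffun I -> bool} => agrees y z x) zs)%:R)
    <= (size zs)%:R * expR (- T)
       + expR (lam - (1 - expR (- lam))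
                     * (k%:R * ((cond_ent R a y - 2 * expR (- T)) / T))).
Proof.
move=> T0 lam0 zsa.
have I0 : (0 < #|I|)%N by apply/card_gt0P; exists i0.
pose p := pprob R a y; have p0 i : 0 < p i by exact: pprob_gt0.
pose J i := - ln (p i).
have J0 i : 0 <= J i by rewrite oppr_ge0 ln_le0// pprob_le1.
have eJ i : expR (J i) = (p i)^-1 by rewrite expRN lnK ?posrE.
pose S (x : {ffun 'I_k -> I}) := \sum_s J (x s).
pose F z i : R := (y i == z i)%:R / p i.
pose G i := expR (- (lam * (J i / T))).
have F0 z i : 0 <= F z i by rewrite divr_ge0// ltW.
have G0 i : 0 <= G i by exact: expR_ge0.
(* Pointwise bound of the indicator. If [S x > T], an agreeing z contributes e^(S x - T), which
   exceeds 1; otherwise the last term is e^(lam - lam S x / T), at least 1. *)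
apply: (@le_trans _ _ (avg (fun x : {ffun 'I_k -> I} =>
   \sum_(z <- zs) expR (- T) * \prod_s F z (x s)
   + expR lam * \prod_s G (x s)))).
  apply: le_avg => x.
  have Fs0 : 0 <= \sum_(z <- zs) expR (- T) * \prod_s F z (x s).
    by apply: sumr_ge0 => z _; rewrite mulr_ge0 ?expR_ge0 ?prodr_ge0.
  have Gs0 : 0 <= expR lam * \prod_s G (x s).
    by rewrite mulr_ge0 ?expR_ge0 ?prodr_ge0.
  case: hasP => [[z zin /forallP agr]|_]; last by rewrite addr_ge0.
  have [ST|ST] := lerP (S x) T.
    apply: (le_trans _ (_ : expR lam * \prod_s G (x s) <= _)); last first.
      by rewrite lerDr.
    rewrite -expR_sum -expRD -[leLHS]expR0 ler_expR sumrN subr_ge0.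
    rewrite -mulr_sumr -mulr_suml ler_piMr// ler_pdivrMr// mul1r; exact: ST.
  apply: (le_trans _ (_ : \sum_(z <- zs) expR (- T) * \prod_s F z (x s) <= _)).
    rewrite (big_rem z)//= -[leLHS]addr0 lerD//; last first.
      by apply: sumr_ge0 => z' _; rewrite mulr_ge0 ?expR_ge0 ?prodr_ge0.
    rewrite (eq_bigr (fun s => expR (J (x s)))); last first.
      by move=> s _; rewrite /F agr mul1r eJ.
    rewrite -expR_sum -expRD -[leLHS]expR0 ler_expR addrC subr_ge0; exact: ltW.
  by rewrite lerDl.
rewrite avgD; apply: lerD.
  rewrite avg_sum; apply: (@le_trans _ _ (\sum_(z <- zs) expR (- T))); last first.
    by rewrite big_const_seq count_predT iter_addr_0 mulr_natl.
  rewrite big_seq [leRHS]big_seq; apply: ler_sum => z /zsa[g zg].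
  rewrite avgZ ler_piMr ?expR_ge0//.
  rewrite -[leRHS](expr1n R k); apply: (avg_prod_le _ (F0 z)).
  rewrite /avg ler_pdivrMr ?ltr0n// mul1r.
  (* Since z is a function of the label, agreement is a weight of total mass 1 on each label, and
     the change of measure bounds the mean of [F z] by 1. *)
  pose w c b : R := (b == g c)%:R.
  apply: le_trans (_ : _ <= \sum_i w (a i) (y i) / p i) _.
    by apply: ler_sum => i _; rewrite /F /w zg.
  apply: le_trans (sum_div_pprob a y _) _ => //.
  rewrite -sum1_card natr_sum; apply: ler_sum => i _.
  by rewrite /w; case: (g _); rewrite ?addr0 ?add0r.
rewrite avgZ expRD ler_wpM2l ?expR_ge0//.
set mu := (cond_ent R a y - _) / T.
have gap : 0 <= 1 - expR (- lam) by rewrite subr_ge0 -expR0 ler_expR oppr_le0.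
have Gavg : avg G <= 1 - (1 - expR (- lam)) * mu.
  (* Truncating J at T loses at most e^(J - T) = e^(- T) / p, and 1 / p has mean at most 2. This is
     the correction [2 * expR (- T)] to the entropy. *)
  have Jmin i : J i - expR (- T) / p i <= Num.min (J i) T.
    rewrite le_min; apply/andP; split.
      by rewrite gerDl oppr_le0 divr_ge0 ?expR_ge0// ltW.
    have := expR_ge1Dx (J i - T); rewrite expRD eJ mulrC; lra.
  have Jm i : G i <= 1 - (1 - expR (- lam)) * (Num.min (J i) T / T).
    apply: (le_trans _ (expR_chord _ _)).
      rewrite ler_expR lerN2 ler_wpM2l// ler_wpM2r ?invr_ge0 ?(ltW T0)//.
      by rewrite ge_min lexx.
    rewrite divr_ge0 ?le_min ?J0 ?(ltW T0)//= ler_pdivrMr// mul1r.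
    by rewrite ge_min lexx orbT.
  apply: le_trans (le_avg Jm) _.
  rewrite avgB (avg_cst i0) avgZ lerD2l lerN2 ler_wpM2l//.
  apply: le_trans (_ : _ <= avg (fun i => (J i - expR (- T) / p i) / T)) _; last first.
    by apply: le_avg => i; rewrite ler_wpM2r ?invr_ge0 ?(ltW T0).
  rewrite /avg -mulr_suml sumrB mulrAC /mu ler_wpM2r ?invr_ge0 ?(ltW T0)//.
  rewrite mulrBl lerD2l lerN2 -mulr_sumr -mulrA mulrC ler_wpM2r ?expR_ge0//.
  rewrite ler_pdivrMr ?ltr0n//.
  have := @sum_div_pprob R I A a y (fun _ _ => 1) (fun _ _ => ler01).
  rewrite sumr_const -[in X in _ <= X]mulr_natr.
  by under eq_bigr do rewrite mul1r.
apply: le_trans (avg_prod_le k G0 Gavg) _.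
rewrite [leRHS](_ : _ = expR (- ((1 - expR (- lam)) * mu)) ^+ k) ?lerXn2r ?nnegrE ?expR_ge0//.
  by apply: le_trans Gavg; exact: avg_ge0.
  exact: expR_ge1Dx.
by rewrite -expRM_natl; congr expR; ring.
Qed.

End Agreement.

(** * First moment *)

Lemma sum_tuple_cons (R : realType) (T : finType) L (F : L.+1.-tuple T -> R) :
  \sum_t F t = \sum_x \sum_(t : L.-tuple T) F [tuple of x :: t].
Proof.
rewrite pair_bigA/= (reindex (fun p : T * L.-tuple T => [tuple of p.1 :: p.2]))//.
exists (fun t => (thead t, [tuple of behead t])).
  by move=> [x t] _ /=; rewrite theadE; congr pair; exact: val_inj.
by move=> t _ /=; rewrite [RHS]tuple_eta.
Qed.

Section Chains.
Variables (R : realType) (Y : finType) (ok : seq Y -> pred Y).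

(** The newest element comes first: each one is tested against the suffix of those chosen before
    it. *)
Fixpoint chain (s : seq Y) : bool :=
  if s is y :: s' then ok s' y && chain s' else true.

Lemma chain_drop s i : chain s -> chain (drop i s).
Proof. by elim: i s => [|i IH] [|y s]//= /andP[_ /IH]. Qed.

Lemma card_chain_le (B0 B : R) L :
  0 <= B0 -> 0 <= B -> #|ok [::]|%:R <= B0 ->
  (forall s, (0 < size s <= L)%N -> #|ok s|%:R <= B) ->
  \sum_(t : L.+1.-tuple Y) (chain t)%:R <= B0 * B ^+ L.
Proof.
move=> B00 Bge0 ok0; elim: L => [|L IH] okB.
  rewrite sum_tuple_cons expr0 mulr1; apply: le_trans ok0.
  rewrite natr_card_sum; apply: ler_sum => y _.
  rewrite (eq_bigr (fun=> (ok [::] y)%:R)) => [|t _].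
    by rewrite sumr_const card_tuple expn0.
  by rewrite [t]tuple0 /= andbT.
rewrite sum_tuple_cons exchange_big/= exprSr mulrA.
apply: le_trans (ler_wpM2r Bge0 (IH _)) => [|s /andP[s0 sL]]; last first.
  by apply: okB; rewrite s0 ltnW.
rewrite mulr_suml; apply: ler_sum => t _.
have [ct|_] /= := boolP (chain t); last first.
  by rewrite big1 ?mul0r// => y _; rewrite andbF.
rewrite mul1r; apply: le_trans (okB t _); last by rewrite size_tuple leqnn.
by rewrite natr_card_sum; apply: ler_sum => y _; rewrite andbT.
Qed.

End Chains.

Section FirstMoment.
Variables (R : realType) (k n : nat).
Implicit Types (y z : assignment n) (c : clause k n).

Definition violates c y : bool := ~~ clause_sat y c.

Definition nviol (m : nat) y (Phi : 'I_m -> clause k n) : nat :=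
  #|[pred i | violates (Phi i) y]|.

Lemma nu_satisfiesE m (nu : R) y (Phi : formula k n m) :
  nu_satisfies nu y Phi <-> (nviol y (tnth Phi))%:R <= nu * m%:R.
Proof.
rewrite /nu_satisfies.
have := cardC [pred i | violates (tnth Phi i) y].
rewrite card_ord -/(nviol y (tnth Phi)) => mE.
rewrite (_ : #|_| = #|[predC [pred i | violates (tnth Phi i) y]]|); last first.
  by apply: eq_card => i; rewrite !inE /violates negbK.
have mR : m%:R = (nviol y (tnth Phi))%:R
    + #|[predC [pred i | violates (tnth Phi i) y]]|%:R :> R by rewrite -natrD mE.
rewrite mulrBl mul1r; split; lra.
Qed.

(** A clause is violated by y when all its signs are opposite to y, which has probability 2^-k and
    leaves the variables uniform. Such a clause is violated by z exactly when z agrees with y on its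
    variables. *)
Lemma violates_prob (i0 : 'I_n) y (zs : seq (assignment n)) :
  2^-1 ^+ k * (1 - avg (fun x : {ffun 'I_k -> 'I_n} =>
                     (has (fun z : assignment n => agrees y z x) zs)%:R))
  <= avg (fun c => (violates c y && ~~ has (violates c) zs)%:R) :> R.
Proof.
have n0 : n%:R != 0 :> R by rewrite pnatr_eq0 -lt0n (leq_trans _ (ltn_ord i0)).
rewrite avg_tuple -[X in X - _](avg_cst ([ffun=> i0] : {ffun 'I_k -> 'I_n}) (1 : R)) -avgB.
rewrite /avg !card_ffun card_prod card_bool !card_ord !natrX natrM exprMn.
rewrite mulrCA exprVn -invfM [in leLHS]mulrC [in leLHS](mulrC (2 ^+ k)).
rewrite [in leLHS]mulrC ler_wpM2r ?invr_ge0 ?mulr_ge0 ?exprn_ge0//.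
pose emb (x : {ffun 'I_k -> 'I_n}) : {ffun 'I_k -> literal n} :=
  [ffun s => (x s, ~~ y (x s))].
have emb_inj : injective emb.
  by move=> x x' /ffunP E; apply/ffunP => s; have := E s; rewrite !ffunE => -[].
pose F (f : {ffun 'I_k -> literal n}) : R :=
  let c := [tuple f i | i < k] in (violates c y && ~~ has (violates c) zs)%:R.
apply: (@le_trans _ _ (\sum_x F (emb x))); last first.
  rewrite -(big_imset F (A := predT)) /=; last by move=> ? ? _ _; exact: emb_inj.
  rewrite big_mkcond/=; apply: ler_sum => f _; case: ifP => _.
    exact: lexx.
  exact: ler0n.
apply: ler_sum => x _; rewrite /F /=.
have viE z : violates [tuple emb x i | i < k] z = agrees y z x.
  rewrite /violates negb_exists; apply: eq_forallb => s.
  by rewrite tnth_mktuple ffunE/=; case: (y _) (z _) => -[].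
have -> : violates [tuple emb x i | i < k] y = true.
  by rewrite viE; apply/forallP.
rewrite (eq_has viE) /=; case: has; rewrite ?subrr ?subr0 //.
Qed.

(** Chernoff's lower tail with parameter [lam] for the number of entries of U violated by some
    assignment that reads them. Counting each entry once, this number is at most the total number of
    violations, hence at most L nu m on the event, while its mean is at least L m q. *)
Lemma first_moment (J : finType) m L (ys : L.-tuple (assignment n))
    (h : 'I_L -> 'I_m -> J) (c0 : clause k n) (q lam nu : R) :
  (forall l, injective (h l)) -> 0 <= lam -> 0 <= q ->
  (forall l : 'I_L, q <= avg (fun c =>
     (violates c (tnth ys l) && ~~ has (violates c) (drop l.+1 ys))%:R)) ->
  avg (fun U : {ffun J -> clause k n} =>
    [forall l, (nviol (tnth ys l) (fun i => U (h l i)))%:R <= nu * m%:R]%:R)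
  <= expR (lam * (L%:R * (nu * m%:R)) - (1 - expR (- lam)) * (L%:R * m%:R * q)).
Proof.
move=> h_inj lam0 q0 hq.
pose g j c : bool := [exists l, (j \in codom (h l)) && violates c (tnth ys l)].
have gap : 0 <= 1 - expR (- lam) by rewrite subr_ge0 -expR0 ler_expR oppr_le0.
apply: (@le_trans _ _ (avg (fun U : {ffun J -> clause k n} =>
    expR (lam * (L%:R * (nu * m%:R))) * \prod_j expR (- lam * (g j (U j))%:R)))).
  apply: le_avg => U; case: forallP => [hU|_]; last first.
    by rewrite mulr_ge0 ?expR_ge0 ?prodr_ge0.
  rewrite -expR_sum -expRD -[leLHS]expR0 ler_expR -mulr_sumr mulNr subr_ge0.
  rewrite ler_wpM2l//.
  apply: (@le_trans _ _ (\sum_l (nviol (tnth ys l) (fun i => U (h l i)))%:R)).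
    under [leRHS]eq_bigr => l _.
      rewrite /nviol natr_card_sum.
      under eq_bigr => i _.
        rewrite (_ : _%:R = \sum_j (h l i == j)%:R * (violates (U j) (tnth ys l))%:R).
          over.
        rewrite (bigD1 (h l i))//= eqxx mul1r big1 ?addr0// => j jh.
        by rewrite eq_sym (negbTE jh) mul0r.
      rewrite exchange_big/=; over.
    rewrite exchange_big/=; apply: ler_sum => j _.
    case: (boolP (g j (U j))) => [/existsP[l /andP[/codomP[i jE] v]]|_].
      rewrite (bigD1 l)//= (bigD1 i)//= -jE eqxx v mul1r -addrA lerDl addr_ge0//.
        by apply: sumr_ge0 => ? _; rewrite mulr_ge0.
      by apply: sumr_ge0 => ? _; apply: sumr_ge0 => ? _; rewrite mulr_ge0.
    by apply: sumr_ge0 => ? _; apply: sumr_ge0 => ? _; rewrite mulr_ge0.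
  apply: (@le_trans _ _ (\sum_(l < L) nu * m%:R)).
    by apply: ler_sum => l _; exact: hU.
  by rewrite sumr_const card_ord mulr_natl.
rewrite avgZ expRD ler_wpM2l ?expR_ge0//.
rewrite (avg_prod (fun j c => expR (- lam * (g j c)%:R))).
pose pi j : R := avg (fun c => (g j c)%:R).
apply: (@le_trans _ _ (\prod_j expR (- (1 - expR (- lam)) * pi j))).
  apply: ler_prod => j _; rewrite avg_ge0 => [|c]; last exact: expR_ge0.
  apply: le_trans (expR_ge1Dx _).
  rewrite [in leRHS]mulNr -[X in X - _](avg_cst c0) -avgZ -avgB; apply: le_avg => c.
  case: (g j c); first by rewrite !mulr1; lra.
  by rewrite !mulr0 expR0 subr0.
rewrite -expR_sum ler_expR -mulr_sumr mulNr lerN2 ler_wpM2l//.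
apply: (@le_trans _ _ (\sum_j \sum_l (j \in codom (h l))%:R * q)).
  rewrite exchange_big/= (eq_bigr (fun=> m%:R * q)).
    by rewrite sumr_const card_ord -mulrA mulr_natl.
  move=> l _; rewrite -mulr_suml -natr_card_sum card_codom ?card_ord//.
apply: ler_sum => j _.
apply: (@le_trans _ _ (avg (fun c => \sum_l (j \in codom (h l))%:R *
     (violates c (tnth ys l) && ~~ has (violates c) (drop l.+1 ys))%:R))).
  by rewrite avg_sum; apply: ler_sum => l _; rewrite avgZ ler_wpM2l.
apply: le_avg => c.
case: (boolP (g j c)) => [_|ng]; last first.
  rewrite big1// => l _; case: (boolP (j \in _)) => [jl|]; last by rewrite mul0r.
  case: (boolP (violates c (tnth ys l))) => vl; last by rewrite mulr0.
  by case/existsP: ng; exists l; rewrite jl.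
pose b l := [&& j \in codom (h l), violates c (tnth ys l) &
  ~~ has (violates c) (drop l.+1 ys)].
have bE l : (j \in codom (h l))%:R *
    (violates c (tnth ys l) && ~~ has (violates c) (drop l.+1 ys))%:R = (b l)%:R :> R.
  by rewrite -natrM mulnb.
rewrite (eq_bigr _ (fun l _ => bE l)).
(* [b l] makes l the last index whose assignment violates c, so at most one l contributes to the
   sum. *)
have b_lt l l' : b l -> b l' -> ~~ (l < l')%N.
  move=> /and3P[_ _ /hasPn nl] /and3P[_ vl' _]; apply/negP => ll'.
  have /nl : tnth ys l' \in drop l.+1 ys.
    rewrite (tnth_nth (tnth ys l)) -(subnKC ll') -nth_drop mem_nth//.
    by rewrite size_drop size_tuple ltn_sub2r// (leq_ltn_trans ll').
  by rewrite vl'.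
case: (pickP b) => [l bl|nb]; last by rewrite big1// => l _; rewrite nb.
rewrite (bigD1 l)//= bl big1 ?addr0// => l' l'l.
case: (boolP (b l')) => // bl'; move: l'l; rewrite -val_eqE neq_ltn.
by rewrite (negbTE (b_lt _ _ bl bl')) (negbTE (b_lt _ _ bl' bl)).
Qed.

End FirstMoment.

(** * Locality and expansion *)

Section Reach.
Variables (k n m : nat).
Implicit Types (Phi : formula k n m) (D : {set 'I_m}) (W : {set 'I_n}).

Definition var_at Phi (i : 'I_m) (a : 'I_k) : 'I_n := (tnth (tnth Phi i) a).1.

Definition vars_of Phi D : {set 'I_n} :=
  [set var_at Phi p.1 p.2 | p in finset.setX D [set: 'I_k]].

Definition touching Phi W : {set 'I_m} :=
  [set i | [exists a, var_at Phi i a \in W]].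

(** An upper bound for the set of variables from which a walk of length at most r uses an edge of a
    clause in D: each round adds all variables sharing a clause with the current set, thus goes two
    edges further. *)
Fixpoint reach Phi D r : {set 'I_n} :=
  if r is r'.+1 then
    reach Phi D r' :|: vars_of Phi (touching Phi (reach Phi D r'))
  else vars_of Phi D.

Definition deg Phi W : nat := \sum_i \sum_a (var_at Phi i a \in W).

Lemma mem_vars_of Phi D i a : i \in D -> var_at Phi i a \in vars_of Phi D.
Proof. by move=> iD; apply/imsetP; exists (i, a); rewrite ?inE ?iD. Qed.

Lemma card_vars_of Phi D : (#|vars_of Phi D| <= k * #|D|)%N.
Proof.
apply: leq_trans (leq_imset_card _ _) _.
by rewrite cardsX cardsT card_ord mulnC.
Qed.

Lemma card_touching Phi W : (#|touching Phi W| <= deg Phi W)%N.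
Proof.
rewrite -sum1_card big_mkcond/= /deg; apply: leq_sum => i _; rewrite inE.
by case: existsP => // -[a aW]; rewrite (bigD1 a)//= aW.
Qed.

Lemma reach_mono Phi D r s : (r <= s)%N -> reach Phi D r \subset reach Phi D s.
Proof.
move=> /subnK <-; elim: (s - r)%N => [|d IH]; first by rewrite add0n.
by rewrite addSn /=; apply: fintype.subset_trans IH _; exact: finset.subsetUl.
Qed.

(** Walks alternate between the two sides, so the induction needs a statement for clause vertices as
    well. *)
Lemma walk_reach Phi D p (u z : vertex (factor_graph Phi)) :
  walk u p z -> has (fun e : edge (factor_graph Phi) => e.1 \in D) p ->
  match u with
  | inl j => is_true (j \in reach Phi D (size p))
  | inr c => c \in D \/ exists a, var_at Phi c a \in reach Phi D (size p)
  end.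
Proof.
elim: p u => [//|[i a] p IH] u [w J W] /= /orP hp.
have up x : x \in reach Phi D (size p) -> x \in reach Phi D (size p).+1.
  by apply/fintype.subsetP; exact: reach_mono.
have base j c : c \in D -> var_at Phi c j \in reach Phi D (size p).+1.
  move=> cD; apply: (fintype.subsetP (reach_mono Phi D (leq0n _))).
  exact: mem_vars_of.
case: J W => -[-> ->] W.
- case: hp => [iD|/(IH _ W) [iD|[a' h]]]; [exact: base|exact: base|].
  rewrite [X in X \in _](_ : _ = var_at Phi i a)// inE; apply/orP; right.
  by apply: mem_vars_of; rewrite inE; apply/existsP; exists a'.
- case: hp => [iD|/(IH _ W) h]; [by left|right]; exists a; exact: up.
Qed.

Lemma walk_transfer Phi Phi' D p (u z : vertex (factor_graph Phi)) :
  (forall i, i \notin D -> tnth Phi i = tnth Phi' i) ->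
  ~~ has (fun e : edge (factor_graph Phi) => e.1 \in D) p ->
  walk u p z -> @walk (factor_graph Phi') u p z.
Proof.
move=> PhiE; elim: p u => [//|e p IH] u /= /norP[eD pD] [w J W].
exists w; last exact: IH.
by move: J; rewrite /joins /= PhiE.
Qed.

Section Local.
Variables (Omega : Type) (r : nat) (Phi Phi' : formula k n m) (D : {set 'I_m}).
Variables (phi : site k n m -> Omega) (j : 'I_n).
Hypothesis PhiE : forall i, i \notin D -> tnth Phi i = tnth Phi' i.
Hypothesis jPhi : j \notin reach Phi D r.

Lemma walk_avoids p (z : vertex (factor_graph Phi)) : (size p <= r)%N ->
  walk (inl j : vertex (factor_graph Phi)) p z ->
  ~~ has (fun e : edge (factor_graph Phi) => e.1 \in D) p.
Proof.
move=> pr W; apply: contra jPhi => /(walk_reach W) /=.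
exact/fintype.subsetP/reach_mono.
Qed.

Lemma near_vertex_transfer (z : vertex (factor_graph Phi)) :
  near_vertex r (inl j : vertex (factor_graph Phi)) z ->
  @near_vertex (factor_graph Phi') r (inl j) z.
Proof.
move=> [p W pr]; exists p => //.
exact: walk_transfer PhiE (walk_avoids pr W) W.
Qed.

Lemma near_edge_transfer (e : edge (factor_graph Phi)) :
  near_edge r (inl j : vertex (factor_graph Phi)) e ->
  e.1 \notin D /\ @near_edge (factor_graph Phi') r (inl j) e.
Proof.
move=> [p [q [z [W pr]]]]; have av := walk_avoids pr W; split.
  by move: av; rewrite has_cat /= => /norP[_ /norP[]].
by exists p, q, z; split=> //; exact: walk_transfer PhiE av W.
Qed.

End Local.

(** Walks of length at most r from j avoid D in both formulas, so they are the same walks, and the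
    identity on vertices and edges is an isomorphism of the two neighborhoods. *)
Lemma local_stable (Omega T : Type) r (f : rooted Omega -> T) Phi Phi' D
    (phi : site k n m -> Omega) (j : 'I_n) : r_local r f ->
  (forall i, i \notin D -> tnth Phi i = tnth Phi' i) ->
  j \notin reach Phi D r -> j \notin reach Phi' D r ->
  f (@Rooted Omega (decorated_factor_graph Phi phi) (inl j)) =
  f (@Rooted Omega (decorated_factor_graph Phi' phi) (inl j)).
Proof.
move=> fr PhiE jP jP'.
have PhiE' i : i \notin D -> tnth Phi' i = tnth Phi i by move=> /PhiE ->.
apply: fr.
pose tv := near_vertex_transfer PhiE jP; pose tv' := near_vertex_transfer PhiE' jP'.
pose te := near_edge_transfer PhiE jP; pose te' := near_edge_transfer PhiE' jP'.
pose G := @Rooted Omega (decorated_factor_graph Phi phi) (inl j).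
pose G' := @Rooted Omega (decorated_factor_graph Phi' phi) (inl j).
pose hv (x : nbhd_vside r G) : nbhd_vside r G' :=
  exist _ (sval x) (tv (inl (sval x)) (svalP x)).
pose hv' (x : nbhd_vside r G') : nbhd_vside r G :=
  exist _ (sval x) (tv' (inl (sval x)) (svalP x)).
pose hc (x : nbhd_cside r G) : nbhd_cside r G' :=
  exist _ (sval x) (tv (inr (sval x)) (svalP x)).
pose hc' (x : nbhd_cside r G') : nbhd_cside r G :=
  exist _ (sval x) (tv' (inr (sval x)) (svalP x)).
pose he (x : nbhd_edge r G) : nbhd_edge r G' :=
  exist _ (sval x) (te (sval x) (svalP x)).2.
pose he' (x : nbhd_edge r G') : nbhd_edge r G :=
  exist _ (sval x) (te' (sval x) (svalP x)).2.
have sig_eq (U : Type) (P : U -> Prop) (x y : {z | P z}) : sval x = sval y -> x = y.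
  by case: x y => x hx [y hy] /= xy; subst y; congr exist; exact: Prop_irrelevance.
exists hv, hc, he; split; [split|split; split].
- by exists hv' => x; exact: sig_eq.
- by exists hc' => x; exact: sig_eq.
- by exists he' => x; exact: sig_eq.
- by move=> [e h]; apply: sig_eq; rewrite /= PhiE'//; case: (te e h).
- by move=> [e h]; exact: sig_eq.
- by congr inl; exact: sig_eq.
- by move=> [e h] /=; rewrite PhiE'//; case: (te e h).
- by case=> [[x hx]|[c hc0]].
- by [].
Qed.

End Reach.

(** * Expansion of random formulas *)

Section Growth.
Variable R : realType.

(** Chernoff's upper tail: [deg Phi W] counts how many of k m independent uniform variables fall in
    W. *)
Lemma deg_tail k n m (W : {set 'I_n}) (X lam : R) : 0 <= lam -> (0 < n)%N ->
  avg (fun Phi : formula k n m => (X <= (deg Phi W)%:R)%R%:R)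
  <= expR ((k * m)%:R * (#|W|%:R / n%:R * expR lam) - lam * X).
Proof.
move=> lam0 n0.
pose wt (l : literal n) : R := expR (lam * (l.1 \in W)%:R).
have wtavg : avg wt <= expR (#|W|%:R / n%:R * expR lam).
  apply: le_trans (expR_ge1Dx _).
  rewrite -(avg_pair (fun j (b : bool) => expR (lam * (j \in W)%:R))).
  under eq_avg do rewrite (avg_cst true).
  rewrite -[X in X + _](avg_cst (Ordinal n0)).
  have -> : #|W|%:R / n%:R = avg (fun j : 'I_n => (j \in W)%:R) :> R.
    by rewrite /avg card_ord natr_card_sum.
  rewrite mulrC -avgZ -avgD.
  apply: le_avg => j; case: (j \in W); last by rewrite !mulr0 expR0 addr0.
  by rewrite !mulr1 lerDr.
pose d (c : clause k n) := (\sum_a ((tnth c a).1 \in W))%N.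
apply: (@le_trans _ _ (avg (fun Phi : {ffun 'I_m -> clause k n} =>
    expR (- (lam * X)) * \prod_i expR (lam * (d (Phi i))%:R)))).
  rewrite avg_tuple; apply: le_avg => g.
  rewrite -expR_sum -mulr_sumr -natr_sum -expRD.
  rewrite (_ : deg _ _ = \sum_i d (g i))%N; last first.
    by apply: eq_bigr => i _; apply: eq_bigr => a _; rewrite /var_at tnth_mktuple.
  case: (boolP (X <= _)) => h; last exact: expR_ge0.
  by rewrite -[leLHS]expR0 ler_expR addrC subr_ge0 ler_wpM2l.
rewrite avgZ addrC expRD ler_wpM2l ?expR_ge0//.
rewrite mulnC natrM -mulrA expRM_natl; 
apply: (@avg_prod_le R m _ (fun c => expR (lam * (d c)%:R))) => [c|].
  exact: expR_ge0.
rewrite expRM_natl avg_tuple.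
rewrite (@eq_avg _ _ _ (fun f : {ffun 'I_k -> literal n} => \prod_s wt (f s))).
  by apply: (@avg_prod_le R k _ wt) => // l; exact: expR_ge0.
move=> f; rewrite /wt -expR_sum -mulr_sumr -natr_sum; congr (expR (lam * _%:R)).
by apply: eq_bigr => a _; rewrite tnth_mktuple.
Qed.

(* A union bound over all [2 ^ n] sets is affordable, because a large
   exponential parameter is paid for by making the sets small. *)
Lemma deg_expansion k n m (Dc del' : R) : 0 < Dc -> 0 < del' -> (0 < n)%N ->
  (k * m)%:R <= Dc * n%:R ->
  avg (fun Phi : formula k n m => [exists W : {set 'I_n},
    (#|W|%:R <= expR (- (3 / del')) / Dc * n%:R) &&
    (del' * n%:R <= (deg Phi W)%:R)]%:R) <= expR (- n%:R) :> R.
Proof.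
move=> Dc0 del0 n0 km.
have nR : 0 < n%:R :> R by rewrite ltr0n.
apply: le_trans (avg_exists_le _ _) _.
apply: (@le_trans _ _ (\sum_(W : {set 'I_n}) expR (- (2 * n%:R)))).
  apply: ler_sum => W _.
  case: (boolP (_ <= expR _ / _ * _)) => Wn /=; last first.
    by rewrite /avg big1 ?mul0r ?expR_ge0.
  (* With [lam = 3 / del'] the tail gains 3 n, and the bound on the size of W keeps the cost at n.
     The remaining e^(- 2 n) beats the number 2^n of sets. *)
  have lam0 : 0 <= 3 / del' by rewrite divr_ge0// ltW.
  apply: le_trans (deg_tail _ _ _ _ lam0 n0) _.
  rewrite ler_expR (_ : 3 / del' * (del' * n%:R) = 3 * n%:R); last first.
    by field; rewrite gt_eqF.
  suff : (k * m)%:R * (#|W|%:R / n%:R * expR (3 / del')) <= n%:R by lra.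
  apply: (@le_trans _ _ (Dc * n%:R * (expR (- (3 / del')) / Dc * expR (3 / del')))).
    by rewrite ler_pM// ?mulr_ge0 ?divr_ge0 ?expR_ge0// ler_wpM2r ?expR_ge0// ler_pdivrMr.
  have e0 : 0 < expR (3 / del') by exact: expR_gt0.
  by rewrite expRN le_eqVlt; apply/orP; left; apply/eqP; field; rewrite !gt_eqF.
rewrite sumr_const -cardsT -powersetT card_powerset cardsT card_ord -[leLHS]mulr_natl natrX.
apply: (@le_trans _ _ (expR n%:R * expR (- (2 * n%:R)))).
  rewrite ler_wpM2r ?expR_ge0// -[n%:R]mulr1 expRM_natl lerXn2r ?nnegrE ?expR_ge0//.
  by apply: (le_trans _ (expR_ge1Dx 1)); lra.
by rewrite -expRD ler_expR; lra.
Qed.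

(** Induction on the radius: if the previous set is small, few literals fall in it, hence few
    clauses touch it and few variables are added. The threshold [del] is chosen before n and m. *)
Lemma reach_expansion k r (Dc del' : R) : (0 < k)%N -> 0 < Dc -> 0 < del' ->
  exists2 del : R, 0 < del & forall n m, (0 < n)%N -> (k * m)%:R <= Dc * n%:R ->
  avg (fun Phi : formula k n m => [exists D : {set 'I_m},
    (#|D|%:R <= del * n%:R) && (del' * n%:R < #|reach Phi D r|%:R)]%:R)
  <= r%:R * expR (- n%:R) :> R.
Proof.
move=> k0 Dc0; have kR : 0 < k%:R :> R by rewrite ltr0n.
elim: r del' => [|r IH] del' del'0.
  exists (del' / k%:R); first exact: divr_gt0.
  move=> n m n0 km; rewrite mul0r /avg big1 ?mul0r// => Phi _.
  case: existsP => // -[D /andP[Dn]]; rewrite ltNge => /negP[].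
  apply: (@le_trans _ _ (k%:R * #|D|%:R)).
    by rewrite -natrM ler_nat card_vars_of.
  by apply: le_trans (ler_wpM2l (ltW kR) Dn) _; rewrite mulrA mulrCA divff ?gt_eqF// mulr1.
(* Each touching clause brings at most k variables, so a degree below e n adds at most half of the
   allowed del' n. *)
pose e := del' / (2 * k%:R); have e0 : 0 < e by rewrite divr_gt0 ?mulr_gt0.
pose del1 := expR (- (3 / e)) / Dc.
have del10 : 0 < del1 by rewrite divr_gt0 ?expR_gt0.
have min0 : 0 < Num.min del1 (del' / 2) by rewrite lt_min del10 divr_gt0.
have [del del0 hdel] := IH _ min0; exists del => // n m n0 km.
have nR : 0 < n%:R :> R by rewrite ltr0n.
rewrite -natr1 mulrDl mul1r.
apply: le_trans (lerD (hdel n m n0 km) (deg_expansion Dc0 e0 n0 km)).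
rewrite -avgD; apply: le_avg => Phi.
case: existsP => [[D /andP[Dn rD]]|_]; last by rewrite addr_ge0.
have [small|big] := lerP #|reach Phi D r|%:R (Num.min del1 (del' / 2) * n%:R).
  rewrite [X in _ <= _ + X](_ : _ = 1) ?lerDr//.
  suff -> : [exists W : {set 'I_n},
    (#|W|%:R <= expR (- (3 / e)) / Dc * n%:R) && (e * n%:R <= (deg Phi W)%:R)] by [].
  apply/existsP; exists (reach Phi D r); apply/andP; split.
    by apply: le_trans small _; rewrite ler_wpM2r// ge_min lexx.
  rewrite leNgt; apply/negP => dsm; move: rD; rewrite ltNge => /negP[].
  apply: (@le_trans _ _ (#|reach Phi D r|%:R + k%:R * (deg Phi (reach Phi D r))%:R)).
    rewrite -natrM -natrD ler_nat; apply: leq_trans (leq_card_setU _ _) _.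
    rewrite leq_add2l; apply: leq_trans (card_vars_of _ _) _.
    by rewrite leq_mul2l card_touching orbT.
  rewrite (_ : del' * _ = del' / 2 * n%:R + k%:R * (e * n%:R)); last first.
    by rewrite /e; field; rewrite gt_eqF.
  apply: lerD; last by rewrite ler_wpM2l ?ltW.
  by apply: le_trans small _; rewrite ler_wpM2r// ge_min lexx orbT.
rewrite [X in _ <= X + _](_ : _ = 1) ?lerDl//.
suff -> : [exists D : {set 'I_m}, (#|D|%:R <= del * n%:R) &&
   (Num.min del1 (del' / 2) * n%:R < #|reach Phi D r|%:R)] by [].
by apply/existsP; exists D; rewrite Dn big.
Qed.

End Growth.

(** * Resampling and block versions *)

Section Resampling.
Variables (R : realType) (I J T : finType).

Definition upd (h : I -> J) (U : {ffun J -> T}) (g : {ffun I -> T}) :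
    {ffun J -> T} :=
  [ffun j => if [pick i | h i == j] is Some i then g i else U j].

Definition pull (h : I -> J) (U : {ffun J -> T}) : {ffun I -> T} :=
  [ffun i => U (h i)].

Lemma updE (h : I -> J) U g i : injective h -> upd h U g (h i) = g i.
Proof.
move=> hi; rewrite ffunE; case: pickP => [i' /eqP /hi -> //|/(_ i)].
by rewrite eqxx.
Qed.

Lemma upd_id (h : I -> J) U g j : (forall i, h i != j) -> upd h U g j = U j.
Proof.
by move=> hj; rewrite ffunE; case: pickP => // i; rewrite (negbTE (hj i)).
Qed.

(** The involution [s] exchanges g with the entries of U along h, so the overwritten function is
    again uniform. *)
Lemma avg_upd (h : I -> J) (F : {ffun J -> T} -> R) : injective h ->
  avg F = avg (fun U => avg (fun g => F (upd h U g))).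
Proof.
move=> hi; rewrite avg_pair.
pose s (p : {ffun J -> T} * {ffun I -> T}) := (upd h p.1 p.2, pull h p.1).
have sK : involutive s.
  move=> [U g]; rewrite /s /=; congr pair.
    apply/ffunP => j; rewrite ffunE; case: pickP => [i /eqP <-|jh].
      by rewrite ffunE.
    by rewrite upd_id// => i; rewrite jh.
  by apply/ffunP => i; rewrite ffunE updE.
have [g0|noT] := pickP {ffun I -> T}; last first.
  rewrite /avg !big1 ?mul0r// => [[U g] _|U _].
    by have := noT g.
  by have := noT (pull h U).
rewrite -[LHS](@eq_avg _ _ (fun U => avg (fun _ : {ffun I -> T} => F U))); last first.
  by move=> U; exact: avg_cst.
rewrite avg_pair (avg_reindex (h := s))//; exact: inv_bij.
Qed.

Lemma avg_pull (h : I -> J) (x0 : T) (A : {ffun I -> T} -> R) : injective h ->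
  avg (fun U => A (pull h U)) = avg A.
Proof.
move=> hi; rewrite (avg_upd _ hi) -[RHS](avg_cst ([ffun=> x0] : {ffun J -> T})).
apply: eq_avg => U; apply: eq_avg => g; congr A; apply/ffunP => i.
by rewrite ffunE updE.
Qed.

End Resampling.

Lemma avg_coord (R : realType) (J T : finType) (x0 : T) (j : J) (F : T -> R) :
  avg (fun U : {ffun J -> T} => F (U j)) = avg F.
Proof.
have j_inj : injective (fun _ : unit => j) by move=> [] [].
rewrite (@eq_avg _ _ _ (fun U => F (pull (fun _ : unit => j) U tt))).
  rewrite (avg_pull x0 (fun g : {ffun unit -> T} => F (g tt)))//.
  rewrite (@avg_reindex _ _ _ (fun x : T => [ffun=> x] : {ffun unit -> T})).
    by apply: eq_avg => x; rewrite /= ffunE.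
  exists (fun g : {ffun unit -> T} => g tt) => [x|g]; first by rewrite ffunE.
  by apply/ffunP => -[]; rewrite ffunE.
by move=> U; rewrite ffunE.
Qed.

(** * Success on all combinations of block versions *)

Section Grid.
Variables (R : realType) (C : finType) (c0 : C) (V m M : nat) (b : 'I_m -> 'I_M).
Local Notation row := {ffun 'I_m -> C}.
Local Notation space := {ffun 'I_V.+1 * 'I_m -> C}.
Implicit Types (U W : space) (x : row) (v : {ffun 'I_M -> 'I_V.+1}).

(** The pool holds V + 1 versions of each of the m clauses; [b] assigns clauses to blocks and v
    picks one version per block. *)
Definition slot v (i : 'I_m) : 'I_V.+1 * 'I_m := (v (b i), i).

Lemma slot_inj v : injective (slot v).
Proof. by move=> i j []. Qed.

Lemma avg_curry (F : space -> R) :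
  avg F = avg (fun W : {ffun 'I_V.+1 -> row} => F [ffun p => W p.1 p.2]).
Proof.
rewrite (@avg_reindex _ _ _ (fun W : {ffun 'I_V.+1 -> row} =>
   [ffun p => W p.1 p.2] : space))//.
exists (fun U => [ffun w => [ffun i => U (w, i)]]).
  by move=> W; apply/ffunP => w; apply/ffunP => i; rewrite !ffunE.
by move=> U; apply/ffunP => -[w i]; rewrite !ffunE.
Qed.

Definition mix (s : nat) U W : space :=
  [ffun p => if val (b p.2) == s then W p else U p].

Lemma avg_mix s (F : space -> R) :
  avg F = avg (fun U => avg (fun W => F (mix s U W))).
Proof.
rewrite avg_pair.
pose t (p : space * space) := (mix s p.1 p.2, mix s p.2 p.1).
have tK : involutive t.
  by move=> [U W]; rewrite /t /=; congr pair; apply/ffunP => p; rewrite !ffunE; case: (_ == s).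
rewrite -[LHS](@eq_avg _ _ (fun U => avg (fun _ : space => F U))); last first.
  by move=> U; exact: (avg_cst [ffun=> c0]).
rewrite avg_pair (avg_reindex (h := t))//; exact: inv_bij.
Qed.

Definition flat x : space := [ffun p => x p.2].
Definition row_of U (w : 'I_V.+1) : row := [ffun i => U (w, i)].

Variable S : pred row.

(** Only the first s blocks range over all versions; the later ones stay at version 0. This
    interpolates between one formula and the full grid. *)
Definition partial_grid (s : nat) U : bool :=
  [forall v : {ffun 'I_M -> 'I_V.+1}, [forall a : 'I_M, (s <= a)%N ==> (v a == ord0)] ==> S (pull (slot v) U)].

Lemma partial_grid_mix s U W :
  partial_grid s (mix s U W) = partial_grid s (mix s U (flat (row_of W ord0))).
Proof.
apply: eq_forallb => v; case: (boolP [forall a, _]) => //= /forallP hv.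
congr S; apply/ffunP => i; rewrite !ffunE /slot /=.
case: eqP => // bi; rewrite ?ffunE /=.
by have := hv (b i); rewrite bi leqnn => /eqP ->.
Qed.

Lemma partial_gridS s U : (forall w, partial_grid s (mix s U (flat (row_of U w)))) ->
  partial_grid s.+1 U.
Proof.
move=> hU; apply/forallP => v; apply/implyP => /forallP hv.
have [sM|Ms] := ltnP s M.
  (* Version [v s] of block s has been copied to all versions of that block, so v may be reset to 0
     there. *)
  have /forallP /(_ [ffun a : 'I_M => if val a == s then ord0 else v a]) :=
    hU (v (Ordinal sM)).
  move=> /implyP h; have {h}/h : [forall a : 'I_M, (s <= a)%N ==>
     ([ffun a : 'I_M => if val a == s then ord0 else v a] a == ord0)].
    apply/forallP => a; apply/implyP; rewrite leq_eqVlt ffunE eq_sym.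
    by case: eqP => //= _ sa; have := hv a; rewrite sa.
  rewrite (_ : pull _ _ = pull (slot v) U)//.
  apply/ffunP => i; rewrite !ffunE /slot /= !ffunE /=.
  case: eqP => // bi; rewrite ?ffunE /=; congr (U (v _, _)).
  exact: val_inj.
have /forallP /(_ v) /implyP h := hU ord0.
have {h}/h : [forall a : 'I_M, (s <= a)%N ==> (v a == ord0)].
  by apply/forallP => a; rewrite leqNgt (leq_trans (ltn_ord a)).
rewrite (_ : pull _ _ = pull (slot v) U)//.
apply/ffunP => i; rewrite !ffunE /slot /=.
by rewrite ltn_eqF// (leq_trans (ltn_ord (b i))).
Qed.

(** Given the other blocks, the V + 1 versions of block s are independent, so all of them succeed
    with the conditional probability to the power V + 1. Jensen's inequality takes this power out of
    the average. *)
Lemma partial_grid_step s :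
  avg (fun U => (partial_grid s U)%:R) ^+ V.+1
    <= avg (fun U => (partial_grid s.+1 U)%:R) :> R.
Proof.
pose q U x : R := (partial_grid s (mix s U (flat x)))%:R.
have q0 U x : 0 <= q U x by exact: ler0n.
have qmix U W x : q (mix s U W) x = q U x.
  by congr (partial_grid s _)%:R; apply/ffunP => p; rewrite !ffunE /=; case: (_ == s).
have qrow U W w : q U (row_of (mix s U W) w) = q U (row_of W w).
  by congr (partial_grid s _)%:R; apply/ffunP => p; rewrite !ffunE /=; case: (_ == s).
have avgq : avg (fun U => (partial_grid s U)%:R) = avg (fun U => avg (q U)) :> R.
  rewrite (avg_mix s); apply: eq_avg => U.
  rewrite (@eq_avg _ _ _ (fun W => q U (row_of W ord0))) => [|W]; last first.
    by rewrite partial_grid_mix.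
  rewrite avg_curry (@eq_avg _ _ _ (fun W : {ffun 'I_V.+1 -> row} => q U (W ord0))).
    by rewrite (avg_coord [ffun=> c0] ord0 (q U)).
  by move=> W; congr (q U _); apply/ffunP => i; rewrite !ffunE.
rewrite avgq; apply: le_trans (exp_avg_le ([ffun=> c0] : space) _ _) _.
  by move=> U; exact: avg_ge0.
rewrite [leRHS](avg_mix s); apply: le_avg => U.
apply: (@le_trans _ _ (avg (fun W : space => \prod_w q U (row_of W w)))).
  rewrite avg_curry (@eq_avg _ _ _ (fun W : {ffun 'I_V.+1 -> row} => \prod_w q U (W w))).
    by rewrite (avg_prod (fun=> q U)) prodr_const card_ord.
  by move=> W; apply: eq_bigr => w _; congr (q U _); apply/ffunP => i; rewrite !ffunE.
apply: le_avg => W; rewrite (eq_bigr (fun w => q (mix s U W) (row_of (mix s U W) w))).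
  case: (boolP (partial_grid s.+1 _)) => [_|/negP np].
    apply: (@le_trans _ _ (\prod_(w < V.+1) 1)); last by rewrite big1_eq.
    by apply: ler_prod => w _; rewrite q0 lern1 leq_b1.
  case: (pickP (fun w => ~~ partial_grid s
      (mix s (mix s U W) (flat (row_of (mix s U W) w))))) => [w nw|all].
    by rewrite (bigD1 w)//= /q (negbTE nw) mul0r.
  by case: np; apply: partial_gridS => w; have := all w; case: partial_grid.
by move=> w _; rewrite qmix qrow.
Qed.

Lemma grid_prob :
  avg (fun x => (S x)%:R) ^+ (V.+1 ^ M)%N
    <= avg (fun U => [forall v : {ffun 'I_M -> 'I_V.+1}, S (pull (slot v) U)]%:R) :> R.
Proof.
have E s : avg (fun x => (S x)%:R) ^+ (V.+1 ^ s)%N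
    <= avg (fun U => (partial_grid s U)%:R) :> R.
  elim: s => [|s IH].
    rewrite expn0 expr1 -(avg_pull c0 _ (@slot_inj [ffun=> ord0])).
    apply: le_avg => U; rewrite ler_nat.
    case: (boolP (S _)) => // SU; rewrite lt0b; apply/forallP => v.
    apply/implyP => /forallP hv; rewrite (_ : v = [ffun=> ord0])//.
    by apply/ffunP => a; rewrite ffunE; have := hv a; rewrite leq0n => /eqP.
  apply: le_trans (partial_grid_step s).
  by rewrite expnSr exprM lerXn2r ?nnegrE ?exprn_ge0 ?avg_ge0.
apply: le_trans (E M) _; apply: le_avg => U; rewrite ler_nat.
case: (boolP (partial_grid _ _)) => // /forallP h; rewrite lt0b.
apply/forallP => v; apply: (implyP (h v)); apply/forallP => a.
by rewrite leqNgt ltn_ord.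
Qed.

End Grid.

(** * Chains of solutions *)

Section Chain.
Variables (R : realType) (n k : nat).
Local Notation asg := (assignment n).
Implicit Types (s : seq asg) (y z : asg).

(** The values at i of the assignments in s, padded with [false] to length k, so that a single
    alphabet of size 2^k serves all lists of length at most k. *)
Definition profile s (i : 'I_n) : {ffun 'I_k -> bool} :=
  [ffun j : 'I_k => nth false [seq (z : asg) i | z <- s] j].

Definition chain_ent s y : R := cond_ent R (profile s) y.

Lemma profile_mem s z : (size s <= k)%N -> z \in s ->
  exists g : {ffun 'I_k -> bool} -> bool, forall i, z i = g (profile s i).
Proof.
move=> sk zs; have zk : (index z s < k)%N by rewrite (leq_trans _ sk)// index_mem.
exists (fun c => c (Ordinal zk)) => i; rewrite ffunE /=.
by rewrite (nth_map z) ?index_mem// nth_index.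
Qed.

Lemma chain_ent_mem s y : (size s <= k)%N -> y \in s -> chain_ent s y = 0.
Proof. by move=> sk /(profile_mem sk)[g yg]; exact: (cond_ent_fun _ yg). Qed.

Lemma chain_ent_continuous s y z (e del : R) : (0 < n)%N -> 0 < e < 1 ->
  hamming R y z <= del ->
  chain_ent s z <= chain_ent s y - ln (1 - e) - del * ln e.
Proof.
move=> n0 e01; rewrite /hamming ler_pdivrMr ?ltr0n// => h.
by apply: cond_ent_continuous => //; rewrite card_ord.
Qed.

Lemma card_chain_ent_le s (h : R) : (0 < n)%N ->
  #|[pred y | chain_ent s y <= h]|%:R
    <= n.+1%:R ^+ (2 ^ k)%N * expR (n%:R * h).
Proof.
move=> n0; have := @card_cond_ent_le R 'I_n _ (profile s) h.
by rewrite card_ffun card_bool !card_ord => /(_ n0).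
Qed.

Lemma hammingC y z : hamming R y z = hamming R z y.
Proof.
by rewrite /hamming; congr (_%:R / _); apply: eq_card => i; rewrite !inE eq_sym.
Qed.

Lemma hamming_triangle x y z : hamming R x z <= hamming R x y + hamming R y z.
Proof.
rewrite /hamming -mulrDl ler_wpM2r ?invr_ge0// !natr_card_sum -big_split/=.
apply: ler_sum => i _; rewrite -natrD ler_nat.
by case: (x i) (y i) (z i) => -[] [].
Qed.

Variables (h0 h1 : R).

Definition window s y : bool := (s == [::]) || (h0 <= chain_ent s y <= h1).

(* Each step of the walk moves the entropy by at most [h1 - h0], so it cannot
   jump over the window on its way from [0] to above [h0]. *)
Lemma chain_exists (Yt : nat -> asg) M : 0 < h0 ->
  (forall s t, (t < k * M)%N ->
     chain_ent s (Yt t.+1) <= chain_ent s (Yt t) + (h1 - h0)) ->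
  (forall ts t, (size ts <= k)%N -> (t <= k * M)%N ->
     all (fun t' => t' + M <= t)%N ts -> h0 < chain_ent (map Yt ts) (Yt t)) ->
  exists ts, [/\ size ts = k.+1, all (fun t => t <= k * M)%N ts &
                 chain window (map Yt ts)].
Proof.
move=> h00 step indep.
(* Strengthened for the induction: the newest time comes first and is the largest, and it grows by
   at most M with each new element. *)
suff chk : exists ts : seq nat,
    [/\ size ts = k.+1, (head 0%N ts <= k * M)%N,
        all (fun t => t <= head 0%N ts)%N ts & chain window (map Yt ts)].
  case: chk => -[|t0 ts] [sz tmax tsmax ch]; first by [].
  exists (t0 :: ts); split=> //; apply/allP => t tin.
  by apply: leq_trans tmax; exact: (allP tsmax).
have: (k <= k)%N by [].
elim: {1 3 4}k => [|l IH] lk.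
  by exists [:: 0%N].
have [[|t0 ts] [sz tmax tsmax ch]] := IH (ltnW lk); first by [].
move: sz tmax tsmax => /= sz tmax tsmax.
have {}tsmax : all (fun t => t <= t0)%N (t0 :: ts) by [].
pose s := map Yt (t0 :: ts).
have sk : (size s <= k)%N by rewrite size_map /= sz.
have up : (t0 + M <= k * M)%N.
  by apply: leq_trans (_ : l.+1 * M <= _)%N; rewrite ?leq_mul2r ?lk ?orbT// mulSn addnC leq_add2l.
(* The next time is the first one from t0 on where the entropy reaches h0: it is 0 at t0, as [Yt t0]
   belongs to s, and above h0 at t0 + M by [indep]. *)
pose P t := (t0 <= t)%N && (h0 <= chain_ent s (Yt t)).
have exP : exists t, P t.
  exists (t0 + M)%N; rewrite /P leq_addr /=; apply/ltW/indep => //.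
    by move: sk; rewrite size_map.
  by apply/allP => t /(allP tsmax) tt0; rewrite leq_add2r.
have [t1 /andP[t01 ht1] t1min] := ex_minnP exP.
have t0s : chain_ent s (Yt t0) = 0.
  by apply: chain_ent_mem => //; rewrite inE eqxx.
have {}t01 : (t0 < t1)%N.
  rewrite ltn_neqAle t01 andbT; apply: contraTneq ht1 => <-.
  by rewrite t0s -ltNge.
have t1M : (t1 <= t0 + M)%N.
  apply: t1min; rewrite /P leq_addr /=; apply/ltW/indep => //.
    by move: sk; rewrite size_map.
  by apply/allP => t /(allP tsmax) tt0; rewrite leq_add2r.
exists [:: t1, t0 & ts]; split => /=.
- by rewrite sz.
- rewrite mulSn addnC; apply: leq_trans t1M _; by rewrite leq_add2r.
- rewrite leqnn (ltnW t01) /=; apply/allP => t tin.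
  by apply: leq_trans (ltnW t01); apply: (allP tsmax); rewrite inE tin orbT.
- apply/andP; split; last exact: ch.
  rewrite /window -[_ :: _]/s ht1 /=.
  case: t1 t01 t1min ht1 t1M => // t1 t01 t1min ht1 t1M.
  have tlow : chain_ent s (Yt t1) < h0.
    rewrite ltNge; apply/negP => hh; have := t1min t1.
    by rewrite ltnn /P -ltnS t01 hh => /(_ isT).
  apply: le_trans (step s t1 _) _; last by lra.
  exact: leq_trans t1M up.
Qed.

End Chain.

(** * First moment bounds for fresh clauses and for chains *)

Section Bounds.
Variables (R : realType) (n k : nat).
Local Notation asg := (assignment n).
Implicit Types (s : seq asg) (y z : asg).

Lemma nviol_prob m y (lam nu : R) : (0 < n)%N -> 0 <= lam ->
  avg (fun g : {ffun 'I_m -> clause k n} => ((nviol y g)%:R <= nu * m%:R)%R%:R)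
  <= expR (lam * (nu * m%:R) - (1 - expR (- lam)) * (m%:R * 2^-1 ^+ k)).
Proof.
move=> n0 lam0; pose i0 := Ordinal n0.
have c0 : clause k n := [tuple (i0, true) | _ < k].
have q0 : 0 <= 2^-1 ^+ k :> R by rewrite exprn_ge0// invr_ge0.
have fm := @first_moment R k n 'I_m m 1 [tuple y] (fun _ => id) c0 (2^-1 ^+ k) lam nu
  (fun _ _ _ => id) lam0 q0.
rewrite !mul1r in fm; apply: (le_trans _ (fm _)) => [|l].
  apply: le_avg => g; rewrite ler_nat.
  case: (boolP (_ <= _)) => // h; rewrite lt0b; apply/forallP => l.
  by rewrite [l]ord1.
have vp := @violates_prob R k n i0 y [::]; move: vp.
rewrite (@eq_avg _ _ _ (fun _ : {ffun 'I_k -> 'I_n} => 0)) //.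
rewrite (avg_cst [ffun=> i0]) subr0 mulr1 [l]ord1; exact.
Qed.

(** Resampling the entries along h leaves [ys U] unchanged. For fixed conditioning assignments, a
    union bound over the few y of small conditional entropy suffices. *)
Lemma fresh_bound (J : finType) m (h : 'I_m -> J)
    (ys : {ffun J -> clause k n} -> seq asg) (ent lam nu : R) :
  (0 < n)%N -> injective h -> (forall U g, ys (upd h U g) = ys U) -> 0 <= lam ->
  avg (fun U => [exists y, ((nviol y (pull h U))%:R <= nu * m%:R) &&
                           (chain_ent R k (ys U) y <= ent)]%:R)
  <= n.+1%:R ^+ (2 ^ k)%N * expR (n%:R * ent) *
     expR (lam * (nu * m%:R) - (1 - expR (- lam)) * (m%:R * 2^-1 ^+ k)).
Proof.
move=> n0 h_inj ysU lam0; set B := expR (_ - _).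
have c0 : clause k n := [tuple (Ordinal n0, true) | _ < k].
rewrite (avg_upd _ h_inj).
rewrite -[leRHS](avg_cst ([ffun=> c0] : {ffun J -> clause k n})).
apply: le_avg => U.
apply: (@le_trans _ _ (avg (fun g : {ffun 'I_m -> clause k n} =>
   [exists y, ((nviol y g)%:R <= nu * m%:R) && (chain_ent R k (ys U) y <= ent)]%:R))).
  apply: le_avg => g; rewrite ysU (_ : pull h (upd h U g) = g)//.
  by apply/ffunP => i; rewrite ffunE updE.
apply: le_trans (avg_exists_le _ _) _.
apply: (@le_trans _ _ (\sum_y (chain_ent R k (ys U) y <= ent)%R%:R * B)).
  apply: ler_sum => y _.
  case: (boolP (_ <= ent)) => _.
    by rewrite mul1r; under eq_avg do rewrite andbT; exact: nviol_prob.
  under eq_avg do rewrite andbF.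
  by rewrite (avg_cst [ffun=> c0]) mul0r.
rewrite -mulr_suml -natr_card_sum ler_wpM2r ?expR_ge0//.
exact: card_chain_ent_le.
Qed.

(** Union bound over chains: 2^n choices for the first assignment, and by the upper end of the
    window a polynomial times e^(n h1) for each later one. By the lower end, a clause violated by an
    assignment is violated by an earlier one with probability at most [ebar], which feeds
    [first_moment]. *)
Lemma chain_bound (J : finType) m (h : 'I_k.+1 -> 'I_m -> J)
    (h0 h1 T mu ebar lam nu : R) :
  (0 < n)%N -> (forall l, injective (h l)) -> 0 <= lam -> 0 < T -> 0 <= mu ->
  k%:R * expR (- T) + expR (mu - (1 - expR (- mu))
     * (k%:R * ((h0 - 2 * expR (- T)) / T))) <= ebar -> ebar <= 1 ->
  avg (fun U : {ffun J -> clause k n} => [exists ys : k.+1.-tuple asg,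
    chain (window k h0 h1) ys &&
    [forall l, (nviol (tnth ys l) (fun i => U (h l i)))%:R <= nu * m%:R]]%:R)
  <= 2 ^+ n * (n.+1%:R ^+ (2 ^ k)%N * expR (n%:R * h1)) ^+ k *
     expR (lam * (k.+1%:R * (nu * m%:R))
           - (1 - expR (- lam)) * (k.+1%:R * m%:R * (2^-1 ^+ k * (1 - ebar)))).
Proof.
move=> n0 h_inj lam0 T0 mu0 Hebar ebar1; set B := expR (_ - _).
have c0 : clause k n := [tuple (Ordinal n0, true) | _ < k].
have q0 : 0 <= 2^-1 ^+ k * (1 - ebar) by rewrite mulr_ge0 ?exprn_ge0 ?invr_ge0 ?subr_ge0.
have gap : 0 <= 1 - expR (- mu) by rewrite subr_ge0 -expR0 ler_expR oppr_le0.
have ebar0 : 0 <= ebar.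
  by apply: le_trans Hebar; rewrite addr_ge0 ?mulr_ge0 ?expR_ge0.
apply: le_trans (avg_exists_le _ _) _.
apply: (@le_trans _ _ (\sum_(ys : k.+1.-tuple asg) (chain (window k h0 h1) ys)%:R * B)).
  apply: ler_sum => ys _.
  case: (boolP (chain _ ys)) => /= chys; last first.
    by rewrite (avg_cst [ffun=> c0]) mul0r.
  rewrite mul1r; apply: (first_moment (h := h)) => // l.
  apply: le_trans (violates_prob R k (Ordinal n0) (tnth ys l) _).
  rewrite ler_wpM2l ?exprn_ge0 ?invr_ge0// lerD2l lerN2.
  have ysl : drop l ys = tnth ys l :: drop l.+1 ys.
    by rewrite (tnth_nth (tnth ys l)) -drop_nth// size_tuple.
  have := chain_drop l chys; rewrite ysl /= => /andP[].
  set s := drop l.+1 ys; set y := tnth ys l.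
  have sk : (size s <= k)%N by rewrite size_drop size_tuple subSS leq_subr.
  rewrite /window => /orP[/eqP -> _|/andP[ent _] _].
    by rewrite (avg_cst [ffun=> Ordinal n0]).
  apply: le_trans (agrees_prob k (a := profile k s) _ (Ordinal n0) T0 mu0 _) _.
    by move=> z zs; exact: profile_mem.
  apply: le_trans Hebar; apply: lerD.
    by rewrite ler_wpM2r ?expR_ge0// ler_nat.
  rewrite ler_expR lerD2l lerN2 ler_wpM2l// ler_wpM2l//.
  by rewrite ler_wpM2r ?invr_ge0 ?(ltW T0)// lerD2r.
rewrite -mulr_suml ler_wpM2r ?expR_ge0//.
apply: card_chain_le.
- by rewrite exprn_ge0.
- by rewrite mulr_ge0 ?exprn_ge0 ?expR_ge0.
- rewrite -natrX ler_nat; apply: leq_trans (max_card _) _.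
  by rewrite card_ffun card_bool card_ord.
- move=> s /andP[s0 _].
  apply: le_trans (card_chain_ent_le k s h1 n0); rewrite ler_nat.
  apply: subset_leq_card; apply/fintype.subsetP => y; rewrite !inE /window.
  by rewrite unfold_in -size_eq0 -leqn0 leqNgt s0 /= => /andP[].
Qed.

End Bounds.

(** * Interpolation path *)

Section Interpolation.
Variables (R : realType) (n k m M r : nat) (b : 'I_m -> 'I_M).
Variables (x : formula k n m -> assignment n).
Variables (h0 h1 T mu ebar lam nu eta del e dsmall dreach : R) (Bsize : nat).
Local Notation row := {ffun 'I_m -> clause k n}.
Local Notation space := {ffun 'I_k.+1 * 'I_m -> clause k n}.
Local Notation time := 'I_(k * M).+1.
Implicit Types (U : space) (Phi : formula k n m).

Hypotheses (n0 : (0 < n)%N) (M0 : (0 < M)%N).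
Hypothesis xlocal : forall Phi Phi' (D : {set 'I_m}) j,
  (forall i, i \notin D -> tnth Phi i = tnth Phi' i) ->
  j \notin reach Phi D r -> j \notin reach Phi' D r -> x Phi j = x Phi' j.
Hypothesis card_block : forall a, (#|[set i | b i == a]| <= Bsize)%N.
Hypothesis Bsmall : Bsize%:R <= dsmall * n%:R.
Hypothesis del_ge : 2 * eta + 2 * dreach <= del.
Hypothesis e01 : 0 < e < 1.
Hypothesis small_step : - ln (1 - e) - del * ln e <= h1 - h0.
Hypothesis h0_gt0 : 0 < h0.

Definition sat_near Phi (y : assignment n) : bool :=
  (hamming R (x Phi) y <= eta) && ((nviol y (tnth Phi))%:R <= nu * m%:R).

Definition success Phi : bool := [exists y, sat_near Phi y].

Definition near_sol Phi : assignment n := odflt [ffun=> false] [pick y | sat_near Phi y].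

Lemma near_solP Phi : success Phi -> sat_near Phi (near_sol Phi).
Proof.
by rewrite /near_sol => /existsP[y hy]; case: pickP => [//|/(_ y)]; rewrite hy.
Qed.

Definition of_row (g : row) : formula k n m := [tuple g i | i < m].

Lemma nviol_of_row y (g : row) : nviol y (tnth (of_row g)) = nviol y g.
Proof. by apply: eq_card => i; rewrite !inE tnth_mktuple. Qed.

(** A time step raises the version of the single block a with M dividing t + a + 1, and M steps
    raise every version by one; k + 1 versions cover the times up to k M. *)
Definition version (t : nat) : {ffun 'I_M -> 'I_k.+1} :=
  [ffun a : 'I_M => inord ((t + a) %/ M)].

Definition state U (t : nat) : formula k n m := of_row (pull (slot b (version t)) U).

Lemma versionE t a : (t <= k * M)%N -> version t a = ((t + a) %/ M)%N :> nat.
Proof.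
move=> tk; rewrite ffunE inordK// ltn_divLR// mulSn addnC.
by rewrite -addSn leq_add// ltn_ord.
Qed.

Lemma version_fresh t t' a : (t <= k * M)%N -> (t' + M <= t)%N ->
  version t a != version t' a.
Proof.
move=> tk tt'; rewrite -val_eqE /= !versionE//; last first.
  by apply: leq_trans tk; apply: leq_trans tt'; exact: leq_addr.
have le : (t' + a + M <= t + a)%N by rewrite addnAC leq_add2r.
rewrite gtn_eqF//; apply: leq_trans (leq_div2r M le).
by rewrite [leqRHS]divnDr ?dvdnn// divnn M0 addn1.
Qed.

Definition changed (t : nat) : {set 'I_m} :=
  [set i | version t (b i) != version t.+1 (b i)].

Lemma card_changed t : (t < k * M)%N -> (#|changed t| <= Bsize)%N.
Proof.
move=> tk; have [->|[i]] := set_0Vmem (changed t); first by rewrite cards0.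
have chM j : j \in changed t -> (M %| (t + b j).+1)%N.
  rewrite inE -val_eqE /= !versionE ?(ltnW tk)// addSn divnS//.
  by case: (M %| _)%N; rewrite // add0n eqxx.
move=> /chM Mi; apply: leq_trans (card_block (b i)).
apply: subset_leq_card; apply/fintype.subsetP => j /chM Mj; rewrite inE.
rewrite -val_eqE /= -(modn_small (ltn_ord (b j))) -(modn_small (ltn_ord (b i))).
rewrite -(eqn_modDl t) -(eqn_modDl 1) !add1n.
by rewrite (eqP Mi) (eqP Mj).
Qed.

Lemma state_unchanged U t i : i \notin changed t ->
  tnth (state U t) i = tnth (state U t.+1) i.
Proof.
rewrite inE negbK !tnth_mktuple => /eqP vE.
by rewrite [LHS]ffunE [RHS]ffunE /slot vE.
Qed.

(** The first of three exceptional events: failure of expansion at some time, a forbidden chain of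
    solutions, and a solution of low entropy given near solutions at least M steps older. *)
Definition far_reaching U : bool :=
  [exists t : time, [exists D : {set 'I_m},
    (#|D|%:R <= dsmall * n%:R) && (dreach * n%:R < #|reach (state U t) D r|%:R)]].

Definition has_chain U : bool :=
  [exists ts : k.+1.-tuple time, [exists ys : k.+1.-tuple (assignment n),
    chain (window k h0 h1) ys &&
    [forall l, (nviol (tnth ys l) (fun i => U (slot b (version (tnth ts l)) i)))%:R
               <= nu * m%:R]]].

Definition has_clump U : bool :=
  [exists p : {bseq k of time} * time,
    all (fun t' : time => t' + M <= p.2)%N p.1 &&
    [exists y, ((nviol y (pull (slot b (version p.2)) U))%:R <= nu * m%:R) &&
      (chain_ent R k [seq near_sol (state U (val t')) | t' <- p.1] y <= h0)]].

(** Outside the first and third events the near solutions along the path satisfy the hypotheses of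
    [chain_exists], and the chain it yields is the second event. *)
Lemma not_all_success U :
  [forall v, success (of_row (pull (slot b v) U))] ->
  [|| far_reaching U, has_chain U | has_clump U].
Proof.
move=> /forallP succ; apply/or3P; apply: contrapT => bad.
have nfar : ~~ far_reaching U by apply/negP => h; apply: bad; constructor 1.
have nchain : ~~ has_chain U by apply/negP => h; apply: bad; constructor 2.
have nclump : ~~ has_clump U by apply/negP => h; apply: bad; constructor 3.
pose Yt t := near_sol (state U t).
have YtP t : sat_near (state U t) (Yt t) by apply: near_solP; exact: succ.
have reach_le t : (t < k * M)%N -> forall t', (t' <= k * M)%N ->
    #|reach (state U t') (changed t) r|%:R <= dreach * n%:R.
  move=> tk t' t'k; rewrite leNgt; apply/negP => h; case/negP: nfar.
  rewrite -ltnS in t'k; apply/existsP; exists (Ordinal t'k).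
  apply/existsP; exists (changed t); rewrite h andbT.
  by apply: le_trans Bsmall; rewrite ler_nat card_changed.
have step s t : (t < k * M)%N ->
    chain_ent R k s (Yt t.+1) <= chain_ent R k s (Yt t) + (h1 - h0).
  move=> tk; apply: (le_trans (chain_ent_continuous (y := Yt t) (del := del) k s n0 e01 _)).
    have /andP[d1 _] := YtP t; have /andP[d2 _] := YtP t.+1.
    (* Outputs differ only at variables reached from the changed clauses in one of the two formulas,
       whence the factor 2. *)
    have d12 : hamming R (x (state U t)) (x (state U t.+1)) <= 2 * dreach.
      rewrite ler_pdivrMr ?ltr0n//.
      have /reach_le re := tk; have re1 := re _ (ltnW tk); have re2 := re _ tk.
      suff : #|[pred j | x (state U t) j != x (state U t.+1) j]|%:R
          <= #|reach (state U t) (changed t) r|%:R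
             + #|reach (state U t.+1) (changed t) r|%:R :> R by lra.
      rewrite -natrD ler_nat; apply: leq_trans (leq_card_setU _ _).
      apply: subset_leq_card; apply/fintype.subsetP => j; rewrite !inE.
      apply: contraR => /norP[j1 j2]; apply/eqP.
      exact: (xlocal (state_unchanged U (t := t)) j1 j2).
    have t1 := hamming_triangle R (Yt t) (x (state U t)) (Yt t.+1).
    have t2 := hamming_triangle R (x (state U t)) (x (state U t.+1)) (Yt t.+1).
    by rewrite hammingC in d1; have dg := del_ge; lra.
  by have ss := small_step; lra.
have fresh ts t : (size ts <= k)%N -> (t <= k * M)%N ->
    all (fun t' => t' + M <= t)%N ts -> h0 < chain_ent R k (map Yt ts) (Yt t).
  move=> tsk tk tsM; rewrite ltNge; apply/negP => h; case/negP: nclump.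
  pose ts' : seq time := map inord ts.
  have ts'k : (size ts' <= k)%N by rewrite size_map.
  have ts'E : [seq val t' | t' <- ts'] = ts.
    rewrite -map_comp map_id_in// => t' /(allP tsM) t't /=; rewrite inordK// ltnS.
    by apply: leq_trans tk; apply: leq_trans t't; exact: leq_addr.
  have tk' : (t < (k * M).+1)%N by [].
  apply/existsP; exists (Bseq ts'k, Ordinal tk') => /=; apply/andP; split.
    by rewrite -(all_map val (fun t' => t' + M <= t)%N) ts'E.
  apply/existsP; exists (Yt t); apply/andP; split.
    by have /andP[_] := YtP t; rewrite nviol_of_row.
  by rewrite (map_comp Yt val) ts'E.
have [ts [tsz tsM tsch]] := chain_exists h0_gt0 step fresh.
case/negP: nchain.
pose ts' : seq time := map inord ts.
have ts'z : size ts' == k.+1 by rewrite size_map tsz.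
have ysz : size (map Yt ts) == k.+1 by rewrite size_map tsz.
apply/existsP; exists (Tuple ts'z); apply/existsP; exists (Tuple ysz).
rewrite tsch /=; apply/forallP => l.
have lts : (l < size ts)%N by rewrite tsz.
rewrite !(tnth_nth (Yt 0%N)) !(tnth_nth ord0) /= (nth_map 0%N)// (nth_map 0%N)//.
rewrite inordK ?ltnS; last exact: (allP tsM _ (mem_nth _ lts)).
have /andP[_] := YtP (nth 0%N ts l); rewrite nviol_of_row => h.
by apply: le_trans h; rewrite ler_nat; apply/eq_leq/eq_card => i; rewrite !inE ffunE.
Qed.

(** [grid_prob] passes to success on all combinations, which forces one of the three exceptional
    events. Each is bounded by a union over the times involved. *)
Lemma success_bound (Dc : R) :
  (forall n' m', (0 < n')%N -> (k * m')%:R <= Dc * n'%:R ->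
    avg (fun Phi : formula k n' m' => [exists D : {set 'I_m'},
      (#|D|%:R <= dsmall * n'%:R) && (dreach * n'%:R < #|reach Phi D r|%:R)]%:R)
    <= r%:R * expR (- n'%:R) :> R) ->
  (k * m)%:R <= Dc * n%:R -> 0 <= lam -> 0 < T -> 0 <= mu ->
  k%:R * expR (- T) + expR (mu - (1 - expR (- mu))
     * (k%:R * ((h0 - 2 * expR (- T)) / T))) <= ebar -> ebar <= 1 ->
  avg (fun Phi => (success Phi)%:R) ^+ (k.+1 ^ M)%N <=
  #|{: time}|%:R * (r%:R * expR (- n%:R)) +
  #|{: k.+1.-tuple time}|%:R *
    (2 ^+ n * (n.+1%:R ^+ (2 ^ k)%N * expR (n%:R * h1)) ^+ k *
     expR (lam * (k.+1%:R * (nu * m%:R))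
           - (1 - expR (- lam)) * (k.+1%:R * m%:R * (2^-1 ^+ k * (1 - ebar))))) +
  #|{: {bseq k of time} * time}|%:R *
    (n.+1%:R ^+ (2 ^ k)%N * expR (n%:R * h0) *
     expR (lam * (nu * m%:R) - (1 - expR (- lam)) * (m%:R * 2^-1 ^+ k))) :> R.
Proof.
move=> reachP km lam0 T0 mu0 Hebar ebar1.
have c0 : clause k n := [tuple (Ordinal n0, true) | _ < k].
rewrite avg_tuple.
apply: le_trans (grid_prob R c0 k b (fun g : row => success (of_row g))) _.
apply: (@le_trans _ _ (avg (fun U => (far_reaching U)%:R) +
  avg (fun U => (has_chain U)%:R) + avg (fun U => (has_clump U)%:R))).
  rewrite -!avgD; apply: le_avg => U; rewrite -!natrD ler_nat.
  case: (boolP [forall v, _]) => // /not_all_success.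
  by case: far_reaching; case: has_chain; case: has_clump.
have card_sum (S : finType) (c : R) : \sum_(i : S) c = #|{: S}|%:R * c.
  by rewrite sumr_const mulr_natl.
rewrite -!card_sum.
apply: lerD; [apply: lerD|].
- apply: le_trans (avg_exists_le _ _) _; apply: ler_sum => t _.
  apply: le_trans (reachP n m n0 km).
  rewrite [leRHS]avg_tuple -[leRHS](avg_pull c0 _ (@slot_inj _ _ _ b (version t))).
  by apply: le_avg => U.
- apply: le_trans (avg_exists_le _ _) _; apply: ler_sum => ts _.
  by apply: (chain_bound (h := fun l => slot b (version (tnth ts l)))) Hebar ebar1 => // l; exact: slot_inj.
- apply: le_trans (avg_exists_le _ _) _; apply: ler_sum => -[ts t] _ /=.
  case: (boolP (all _ ts)) => [/allP tsM|_]; last first.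
    by rewrite (avg_cst [ffun=> c0]) !mulr_ge0 ?exprn_ge0 ?expR_ge0.
  apply: (fresh_bound (ys := fun U => [seq near_sol (state U (val t')) | t' <- ts])) => //.
    exact: slot_inj.
  (* Times at least M apart share no slot, so overwriting the slots of time t leaves the earlier
     formulas unchanged. *)
  move=> U g; apply/eq_in_map => t' /tsM t't; congr (near_sol (of_row _)).
  apply/ffunP => i; rewrite [LHS]ffunE [RHS]ffunE upd_id// => j; apply/eqP => -[vE ji].
  by have := @version_fresh t t' (b i) (leq_ord t) t't; rewrite -vE ji eqxx.
Qed.

End Interpolation.

(** * Choice of the parameters *)

Section Asymptotics.
Variable R : realType.

Lemma overlap_lt1 (b : R) : 1 < b -> b * expR (- (b - 1)) < 1.
Proof.
move=> b1; rewrite expRN ltr_pdivrMr ?expR_gt0// mul1r.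
rewrite -{1}(subrK 1 b) addrC; apply: expR_gt1Dx.
by rewrite subr_eq0 gt_eqF.
Qed.

Lemma kappa_star_lt (kappa : R) : kappa_star R < kappa ->
  exists2 b : R, 1 < b & b < kappa * (1 - b * expR (- (b - 1))).
Proof.
move=> /inf_lt[]; first by exists (iota_fun 2); exists 2 => //=; rewrite ltr1n.
move=> _ [b /= b1 <-] bk; exists b => //.
by rewrite -ltr_pdivrMr// subr_gt0 overlap_lt1.
Qed.

Lemma expRN_le (y d : R) : 0 < d -> d^-1 <= y -> expR (- y) <= d.
Proof.
move=> d0 dy; rewrite expRN -[leRHS]invrK lef_pV2 ?posrE ?expR_gt0 ?invr_gt0//.
by apply: le_trans dy _; apply: le_trans (expR_ge1Dx y); rewrite lerDr.
Qed.

Lemma ln_le_self (y : R) : 0 < y -> ln y <= y.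
Proof.
move=> y0; have := le_ln1Dx (x := y - 1).
by rewrite addrCA subrr addr0 => h; apply: le_trans (h _) _; lra.
Qed.

Lemma oppr_ln1B_le (e : R) : 0 <= e <= 2^-1 -> - ln (1 - e) <= 2 * e.
Proof.
move=> /andP[e0 e1]; have p0 : 0 < 1 - e by lra.
rewrite -lnV ?posrE//; have -> : (1 - e)^-1 = 1 + e / (1 - e).
  by field; rewrite gt_eqF.
apply: le_trans (le_ln1Dx _) _.
  by apply: lt_le_trans (_ : 0 <= _); rewrite ?divr_ge0 ?(ltW p0)//; lra.
by rewrite ler_pdivrMr//; nra.
Qed.

(** Conditions for one k, with [lam = ln k] and clause density A 2^k. The last two fields bound the
    exponents per variable of the chain and fresh-clause first moments; there A / k^2 comes from nu,
    and the leading 1 bounds ln 2. *)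
Record admissible (kappa : R) (k : nat) (h0 h1 T mu ebar e c : R) : Prop := {
  adm_k : (1 < k)%N;
  adm_h0 : 0 < h0;
  adm_e : 0 < e < 1;
  adm_step : - ln (1 - e) - 3 / k%:R ^+ 2 * ln e <= h1 - h0;
  adm_T : 0 < T;
  adm_mu : 0 <= mu;
  adm_ebar : k%:R * expR (- T) + expR (mu - (1 - expR (- mu))
     * (k%:R * ((h0 - 2 * expR (- T)) / T))) <= ebar;
  adm_ebar1 : ebar <= 1;
  adm_c : 0 < c;
  adm_chain : let A := kappa * ln k%:R / k%:R in
     1 + k%:R * h1 + ln k%:R * (k.+1%:R * (A / k%:R ^+ 2))
       - (1 - k%:R^-1) * (k.+1%:R * (A * (1 - ebar))) <= - c;
  adm_clump : let A := kappa * ln k%:R / k%:R in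
     h0 + ln k%:R * (A / k%:R ^+ 2) - (1 - k%:R^-1) * A <= - c }.

(* [b] nearly attains the infimum of [iota_fun]; the entropy window
   [(b + g / 4, b + g / 2) ln k / k] sits between [b] and [kappa (1 - q)],
   where [q = b e^(1 - b)] bounds the overlap probability. *)
Lemma large_k (kappa b : R) : 1 < b -> b < kappa * (1 - b * expR (- (b - 1))) ->
  exists kst : nat, forall k, (kst <= k)%N ->
  exists h0 h1 T mu ebar e c, admissible kappa k h0 h1 T mu ebar e c.
Proof.
move=> b1 bkappa; set q := b * _ in bkappa; pose g := kappa * (1 - q) - b.
have g0 : 0 < g by rewrite subr_gt0.
have q0 : 0 < q by rewrite mulr_gt0 ?expR_gt0//; lra.
have q1 : 0 < 1 - q by rewrite subr_gt0; exact: overlap_lt1.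
have kappa0 : 0 < kappa by rewrite -(pmulr_lgt0 _ q1); lra.
(* With [T = (1 + ep) ln k] the union over k assignments costs k^(- ep), while b (1 + ep) = b + g /
   8 stays below b + g / 4. *)
pose ep := g / (8 * b); have ep0 : 0 < ep by rewrite divr_gt0// mulr_gt0//; lra.
(* Once k^(- ep) is at most d, [ebar] is at most 1 and the overlap term loses at most g / 8 of the
   margin g. *)
pose d := Num.min (1 - q) (g / (8 * kappa)).
have d0 : 0 < d by rewrite lt_min q1 divr_gt0// mulr_gt0.
(* Lower bounds required of ln k: 32 / g absorbs additive constants, 24 kappa / g makes kappa / k at
   most g / 24, and d^-1 / ep makes k^(- ep) at most d. *)
pose X := 2 + 32 / g + 24 * kappa / g + d^-1 / ep.
exists (Num.truncn (expR X)).+1 => k kst.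
have kX : expR X < k%:R.
  apply: lt_le_trans (truncnS_gt _) _; by rewrite ler_nat.
have k0 : 0 < k%:R :> R by apply: lt_trans kX; exact: expR_gt0.
pose x := ln k%:R : R.
have xX : X <= x by rewrite -ler_expR lnK ?posrE ?ltW.
have g32 : 0 < 32 / g by rewrite divr_gt0.
have kg : 0 < 24 * kappa / g by rewrite divr_gt0 ?mulr_gt0.
have dep : 0 < d^-1 / ep by rewrite divr_gt0 ?invr_gt0.
have x2 : 2 <= x by rewrite /X in xX; lra.
have x0 : 0 < x by lra.
have xk : x <= k%:R by exact: ln_le_self.
have x32 : 32 <= g * x by rewrite -ler_pdivrMl// mulrC; rewrite /X in xX; lra.
have x24 : 24 * kappa <= g * x.
  by rewrite -ler_pdivrMl// mulrC; rewrite /X in xX; lra.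
have xd : expR (- (ep * x)) <= d.
  by apply: expRN_le => //; rewrite -ler_pdivrMl// mulrC; rewrite /X in xX; lra.
have dq : d <= 1 - q by rewrite ge_min lexx.
have dg : kappa * d <= g / 8.
  have : d <= g / (8 * kappa) by rewrite ge_min lexx orbT.
  by rewrite ler_pdivlMr ?mulr_gt0//; lra.
have eT : k%:R * expR (- ((1 + ep) * x)) = expR (- (ep * x)).
  by rewrite -{1}(lnK k0) -expRD; congr expR; rewrite -/x; ring.
pose ebar := expR (- (ep * x)) + q.
pose iv := k%:R^-1 : R.
have iv0 : 0 < iv by rewrite invr_gt0.
have kiv : k%:R * iv = 1 by rewrite mulfV ?gt_eqF.
have xiv0 : 0 < x * iv by rewrite mulr_gt0.
have xiv : x * iv <= 1 by rewrite ler_pdivrMr// mul1r.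
have iv2 : iv <= 2^-1 by rewrite lef_pV2 ?posrE//; lra.
have ivg : kappa * iv <= g / 24 by rewrite ler_pdivrMr//; nra.
have giv : iv <= g / 32 by rewrite -[iv]mul1r ler_pdivrMr//; nra.
have ivx : iv <= x * iv by rewrite ler_peMl ?(ltW iv0)//; lra.
exists ((b + g / 4) * x * iv), ((b + g / 2) * x * iv), ((1 + ep) * x), (ln b),
  ebar, (iv ^+ 2), (x * iv * (g / 4)).
have kE : k.+1%:R = k%:R + 1 :> R by rewrite natr1.
split.
- by rewrite -(ltr_nat R); lra.
- by rewrite !mulr_gt0//; lra.
- by rewrite exprn_gt0//= expr_lt1 ?ltW//; lra.
- have e2 : 0 <= iv ^+ 2 <= 2^-1 by rewrite exprn_ge0 ?ltW//=; nra.
  have := oppr_ln1B_le e2; rewrite lnXn// /iv lnV ?posrE// -/iv -/x -exprVn -/iv.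
  have : 8 * x * iv ^+ 2 <= g / 4 * (x * iv).
    rewrite (_ : 8 * x * iv ^+ 2 = 8 * iv * (x * iv)); last by ring.
    by rewrite ler_wpM2r ?mulr_ge0 ?(ltW iv0) ?(ltW x0)//; lra.
  have : 2 * iv ^+ 2 <= 2 * x * iv ^+ 2.
    by rewrite ler_wpM2r ?exprn_ge0 ?(ltW iv0)//; lra.
  rewrite -[- x *+ 2]mulr_natl; nra.
- by rewrite mulr_gt0//; lra.
- by rewrite ln_ge0// ltW.
- rewrite eT lerD2l [expR (- ln b)]expRN lnK ?posrE; last by lra.
  have T0 : 0 < (1 + ep) * x by rewrite mulr_gt0//; lra.
  have bi : 0 <= 1 - b^-1 by rewrite subr_ge0 invf_le1; lra.
  (* [mu = ln b] minimizes mu - (1 - e^(- mu)) b, and the exponential of the minimum is q. *)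
  apply: (@le_trans _ _ (expR (ln b - (1 - b^-1) * b))); last first.
    rewrite expRD lnK ?posrE; last by lra.
    by rewrite mulrBl mul1r mulVf// gt_eqF//; lra.
  rewrite ler_expR lerD2l lerN2 ler_wpM2l// mulrA ler_pdivlMr//.
  have -> : k%:R * ((b + g / 4) * x * iv - 2 * expR (- ((1 + ep) * x)))
      = (b + g / 4) * x * (k%:R * iv) - 2 * (k%:R * expR (- ((1 + ep) * x))).
    by ring.
  rewrite eT kiv mulr1.
  have -> : b * ((1 + ep) * x) = b * x + g * x / 8.
    by rewrite /ep; field; lra.
  have E1 : expR (- (ep * x)) <= 1 by lra.
  have -> : (b + g / 4) * x = b * x + g * x / 4 by ring.
  lra.
- by rewrite /ebar; lra.
- by rewrite !mulr_gt0.
(* The main terms are (b + g / 2) ln k against kappa (1 - ebar) ln k, at least (b + 7 g / 8) ln k.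
   The difference absorbs the lower order terms and c. *)
- rewrite /= -/x -/iv -exprVn -/iv kE.
  have -> : k%:R * ((b + g / 2) * x * iv) = (b + g / 2) * x * (k%:R * iv) by ring.
  have -> : x * ((k%:R + 1) * (kappa * x * iv * iv ^+ 2))
     = kappa * x * ((x * iv) * ((k%:R * iv + iv) * iv)) by ring.
  have -> : (1 - iv) * ((k%:R + 1) * (kappa * x * iv * (1 - ebar)))
     = kappa * x * ((1 - iv) * (k%:R * iv + iv) * (1 - ebar)) by ring.
  rewrite kiv !mulr1.
  have kx0 : 0 <= kappa * x by rewrite mulr_ge0 ?ltW.
  have h1 : kappa * x * (x * iv * ((1 + iv) * iv)) <= kappa * x * (2 * iv).
    by rewrite ler_wpM2l//; nra.
  have eb0 : 0 <= 1 - ebar by rewrite /ebar; lra.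
  have h2 : kappa * x * ((1 - iv) * (1 - ebar))
      <= kappa * x * ((1 - iv) * (1 + iv) * (1 - ebar)).
    by rewrite ler_wpM2l// ler_wpM2r//; nra.
  have h3 : kappa * x * (1 - ebar - iv) <= kappa * x * ((1 - iv) * (1 - ebar)).
    rewrite ler_wpM2l//; have : 0 <= iv * ebar.
      by rewrite mulr_ge0 ?(ltW iv0)// /ebar addr_ge0 ?expR_ge0 ?(ltW q0).
    by lra.
  have h4 : x * (b + g * (7 / 8) - kappa * iv) <= kappa * x * (1 - ebar - iv).
    rewrite [leRHS](_ : _ = x * (kappa * (1 - ebar - iv))); last by ring.
    rewrite ler_wpM2l ?(ltW x0)// /ebar.
    have := ler_wpM2l (ltW kappa0) xd; rewrite /g; rewrite /g in dg; lra.
  have h5 : x * (3 * (kappa * iv)) <= x * (g / 8) by rewrite ler_wpM2l ?(ltW x0)//; lra.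
  have h6 : x * g * iv <= x * g * 2^-1 by rewrite ler_wpM2l// mulr_ge0 ?(ltW x0) ?(ltW g0).
  have h7 : kappa * x * (2 * iv) = x * (2 * (kappa * iv)) by ring.
  lra.
- rewrite /= -/x -/iv -exprVn -/iv.
  have -> : x * (kappa * x * iv * iv ^+ 2) = x * iv * (kappa * iv * (x * iv)) by ring.
  have -> : (1 - iv) * (kappa * x * iv) = x * iv * (kappa - kappa * iv) by ring.
  have -> : (b + g / 4) * x * iv = x * iv * (b + g / 4) by ring.
  rewrite -mulrDr -mulrBr -[leRHS]mulrN ler_wpM2l ?(ltW xiv0)//.
  have : kappa * iv * (x * iv) <= kappa * iv by rewrite ler_piMr// mulr_ge0 ?(ltW iv0) ?(ltW kappa0).
  have : 0 < kappa * q by rewrite mulr_gt0.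
  by rewrite /g; rewrite /g in ivg; lra.
Qed.

(** With u = c / (a + 1), e^(c n) is at least (u n)^(a + 1), one factor n more than (n + 1)^a <= (2
    n)^a. *)
Lemma poly_le_expR (K c : R) (a : nat) : 0 < c ->
  exists N : nat, forall n, (N <= n)%N -> K * n.+1%:R ^+ a <= expR (c * n%:R).
Proof.
move=> c0; pose u := c / a.+1%:R; have u0 : 0 < u by rewrite divr_gt0.
pose L := Num.max K 0 * 2 ^+ a / u ^+ a.+1.
exists (maxn 1 (Num.truncn L).+1) => n; rewrite geq_max => /andP[n1 nL].
have nR : 0 < n%:R :> R by rewrite ltr0n.
have Ln : L <= n%:R by apply/ltW/(lt_le_trans (truncnS_gt _)); rewrite ler_nat.
apply: (@le_trans _ _ ((u * n%:R) ^+ a.+1)); last first.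
  rewrite [c * _](_ : _ = a.+1%:R * (u * n%:R)); last first.
    by rewrite /u mulrCA mulrA mulfVK.
  have un0 : 0 <= u * n%:R by rewrite mulr_ge0 ?(ltW u0).
  rewrite expRM_natl lerXn2r ?nnegrE ?expR_ge0//.
  by apply: (le_trans _ (expR_ge1Dx _)); rewrite lerDr.
have K0 : 0 <= Num.max K 0 by rewrite le_max lexx orbT.
apply: (@le_trans _ _ (Num.max K 0 * n.+1%:R ^+ a)).
  by rewrite ler_wpM2r ?exprn_ge0// le_max lexx.
apply: (@le_trans _ _ (Num.max K 0 * (2 ^+ a * n%:R ^+ a))).
  rewrite ler_wpM2l// -exprMn lerXn2r ?nnegrE ?mulr_ge0// -natrM ler_nat; lia.
have H : Num.max K 0 * 2 ^+ a <= u ^+ a.+1 * n%:R.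
  by rewrite -ler_pdivrMl ?exprn_gt0// mulrC.
rewrite exprMn [n%:R ^+ a.+1]exprSr mulrA [leRHS]mulrA.
rewrite [leRHS]mulrAC.
by rewrite ler_wpM2r ?exprn_ge0.
Qed.

End Asymptotics.

(** * Exponential bound for a fixed value of the randomness *)

Section Hardness.
Variable R : realType.

(** The number M of blocks does not depend on n, so taking the root of order V = (k + 1)^M only
    divides the rate in the exponent by a constant. *)
Lemma finite_hardness (kappa : R) (k r : nat) (h0 h1 T mu ebar e c : R) :
  0 < kappa -> admissible kappa k h0 h1 T mu ebar e c ->
  exists (nst : nat) (C : R), 0 < C /\ forall n, (nst <= n)%N ->
  let m := Num.truncn (kappa * 2 ^+ k * ln k%:R / k%:R * n%:R) in
  forall x : formula k n m -> assignment n,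
  (forall Phi Phi' (D : {set 'I_m}) j,
    (forall i, i \notin D -> tnth Phi i = tnth Phi' i) ->
    j \notin reach Phi D r -> j \notin reach Phi' D r -> x Phi j = x Phi' j) ->
  avg (fun Phi => (@success R n k m x (k%:R ^+ 2 * 2 ^+ k)^-1 (k%:R ^+ 2)^-1 Phi)%:R)
    <= expR (- (C * n%:R)) :> R.
Proof.
move=> kappa0 adm; set alpha := kappa * _ * _ / _.
have k1 := adm_k adm; have k0 : (0 < k)%N by exact: ltnW.
have kR : 0 < k%:R :> R by rewrite ltr0n.
have k1R : 1 < k%:R :> R by rewrite ltr1n.
pose A := kappa * ln k%:R / k%:R.
have lnk0 : 0 < ln k%:R :> R by rewrite ln_gt0.
have A0 : 0 < A by rewrite divr_gt0 ?mulr_gt0.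
have pk0 : 0 < 2 ^+ k :> R by rewrite exprn_gt0.
have alphaE : alpha = A * 2 ^+ k by rewrite /alpha /A; ring.
clearbody alpha.
have alpha0 : 0 < alpha by rewrite alphaE mulr_gt0.
have Dc0 : 0 < k%:R * alpha by rewrite mulr_gt0.
(* With eta = k^-2 this gives 2 eta + 2 dreach = 3 / k^2, the displacement allowed by [adm_step]. *)
pose dreach : R := (2 * k%:R ^+ 2)^-1.
have dreach0 : 0 < dreach by rewrite invr_gt0 mulr_gt0 ?exprn_gt0.
have [dsmall ds0 reachP] := reach_expansion r k0 Dc0 dreach0.
(* For large n the block size, the integer part of dsmall n, is at least dsmall n / 2, so M blocks
   cover the m slots. *)
pose M := (Num.truncn (2 * alpha / dsmall)).+1.
pose V := (k.+1 ^ M)%N; have V0 : (0 < V)%N by rewrite expn_gt0.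
pose t1 : R := #|{: 'I_(k * M).+1}|%:R.
pose t2 : R := #|{: k.+1.-tuple 'I_(k * M).+1}|%:R.
pose t3 : R := #|{: {bseq k of 'I_(k * M).+1} * 'I_(k * M).+1}|%:R.
(* The factors e^(k + 1) and e pay for the rounding in m, which loses at most one clause. *)
pose K := t1 * r%:R + t2 * expR k.+1%:R + t3 * expR 1.
pose a := (2 ^ k * k + 2 ^ k)%N.
pose c2 := Num.min c 1; have c20 : 0 < c2 by rewrite lt_min (adm_c adm) ltr01.
have c2c : c2 <= c by rewrite ge_min lexx.
have c21 : c2 <= 1 by rewrite ge_min lexx orbT.
have c20' : 0 < c2 / 2 by rewrite divr_gt0.
have [N hN] := poly_le_expR K a c20'.
exists (maxn N (Num.truncn (2 / dsmall)).+1), (c2 / 2 / V%:R).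
split; first by rewrite divr_gt0// ltr0n.
move=> n; rewrite geq_max => /andP[nN nd] m x xlocal.
have nR : 2 / dsmall <= n%:R.
  by apply/ltW/(lt_le_trans (truncnS_gt _)); rewrite ler_nat.
have ds2 : 2 <= dsmall * n%:R by rewrite mulrC -ler_pdivrMr.
have n0 : (0 < n)%N by exact: leq_trans nd.
have n0R : 0 < n%:R :> R by rewrite ltr0n.
have m_le : m%:R <= alpha * n%:R by rewrite truncn_le mulr_ge0 ?ltW.
have m_ge : alpha * n%:R - 1 <= m%:R.
  by have := truncnS_gt (alpha * n%:R); rewrite -natr1 -/m; lra.
pose Bs := Num.truncn (dsmall * n%:R).
have Bs_le : Bs%:R <= dsmall * n%:R by rewrite truncn_le mulr_ge0 ?ltW.
have Bs_ge : dsmall * n%:R / 2 <= Bs%:R.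
  by have := truncnS_gt (dsmall * n%:R); rewrite -natr1 -/Bs; lra.
have Bs0 : (0 < Bs)%N by rewrite -(ltr_nat R); lra.
have mMB : (m <= M * Bs)%N.
  rewrite -(ler_nat R) natrM; apply: le_trans m_le _.
  apply: (@le_trans _ _ (2 * alpha / dsmall * (dsmall * n%:R / 2))).
    by rewrite le_eqVlt; apply/orP; left; apply/eqP; field; rewrite gt_eqF.
  apply: ler_pM => //.
  - by rewrite divr_ge0 ?(ltW ds0)// mulr_ge0// ltW.
  - by rewrite divr_ge0// mulr_ge0// ltW.
  by apply: ltW; exact: truncnS_gt.
have blk (i : 'I_m) : (i %/ Bs < M)%N.
  by rewrite ltn_divLR//; apply: leq_trans mMB.
pose b (i : 'I_m) : 'I_M := Ordinal (blk i).
have cardb t : (#|[set i | b i == t]| <= Bs)%N.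
  pose f (i : 'I_m) : 'I_Bs := Ordinal (ltn_pmod i Bs0).
  rewrite -(card_in_imset (f := f)) => [|i j]; last first.
    rewrite !inE => /eqP it /eqP jt /(congr1 val) /= ij; apply: val_inj => /=.
    have /(congr1 val) /= dij : b i = b j by rewrite it jt.
    by rewrite (divn_eq i Bs) (divn_eq j Bs) dij ij.
  by rewrite -[leqRHS](card_ord Bs) max_card.
have del_ok : 2 * (k%:R ^+ 2)^-1 + 2 * dreach <= 3 / k%:R ^+ 2.
  rewrite /dreach le_eqVlt; apply/orP; left; apply/eqP; field.
  by rewrite gt_eqF.
have km : (k * m)%:R <= k%:R * alpha * n%:R.
  by rewrite natrM -mulrA ler_wpM2l.
have M0 : (0 < M)%N by [].
have sb := success_bound (k%:R ^+ 2 * 2 ^+ k)^-1 n0 M0 xlocal cardb Bs_le del_ok (adm_e adm)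
  (adm_step adm) (adm_h0 adm) reachP km (ltW lnk0) (adm_T adm) (adm_mu adm)
  (adm_ebar adm) (adm_ebar1 adm).
set p := avg _ in sb *.
have p0 : 0 <= p by apply: avg_ge0 => Phi; exact: ler0n.
suff main : p ^+ V <= expR (- (c2 / 2 * n%:R)).
  rewrite -(@ler_pXn2r _ V)// ?nnegrE ?expR_ge0//.
  rewrite -expRM_natl mulrN; apply: le_trans main _.
  rewrite ler_expR lerN2 le_eqVlt; apply/orP; left; apply/eqP.
  by field; rewrite pnatr_eq0 -lt0n.
apply: le_trans sb _.
pose P := n.+1%:R ^+ a : R.
have nu_m : (k%:R ^+ 2 * 2 ^+ k)^-1 * m%:R <= A / k%:R ^+ 2 * n%:R.
  apply: (@le_trans _ _ ((k%:R ^+ 2 * 2 ^+ k)^-1 * (alpha * n%:R))).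
    by rewrite ler_wpM2l// invr_ge0 mulr_ge0 ?exprn_ge0.
  rewrite alphaE le_eqVlt; apply/orP; left; apply/eqP; field.
  by rewrite !gt_eqF ?exprn_gt0.
have m_pk : A * n%:R - 1 <= m%:R * 2^-1 ^+ k.
  rewrite exprVn ler_pdivlMr// mulrBl mul1r.
  rewrite mulrAC -alphaE; apply: le_trans m_ge; rewrite lerD2l lerN2.
  by rewrite exprn_ege1// ler1n.
have ik0 : 0 < k%:R^-1 :> R by rewrite invr_gt0.
have ik1 : 0 <= 1 - k%:R^-1 :> R by rewrite subr_ge0 invf_le1// ltW.
have eb1 : 0 <= 1 - ebar by rewrite subr_ge0 (adm_ebar1 adm).
have eb0 : 1 - ebar <= 1.
  rewrite gerBl; apply: le_trans (adm_ebar adm).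
  by rewrite addr_ge0 ?mulr_ge0 ?expR_ge0.
have elnk : expR (- ln k%:R) = k%:R^-1 :> R by rewrite expRN lnK.
have n1P q : (q <= a)%N -> n.+1%:R ^+ q <= P.
  by move=> qa; rewrite ler_weXn2l// ler1n.
have P1 : 1 <= P by have := n1P 0%N (leq0n _); rewrite expr0.
have term1 : t1 * (r%:R * expR (- n%:R)) <= t1 * r%:R * P * expR (- (c2 * n%:R)).
  rewrite -!mulrA !ler_wpM2l//; apply: (@le_trans _ _ (1 * expR (- (c2 * n%:R)))).
    by rewrite mul1r ler_expR lerN2 ler_piMl.
  by rewrite ler_wpM2r ?expR_ge0.
have term2 : 2 ^+ n * (n.+1%:R ^+ (2 ^ k)%N * expR (n%:R * h1)) ^+ k *
     expR (ln k%:R * (k.+1%:R * ((k%:R ^+ 2 * 2 ^+ k)^-1 * m%:R))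
       - (1 - expR (- ln k%:R)) * (k.+1%:R * m%:R * (2^-1 ^+ k * (1 - ebar))))
    <= expR k.+1%:R * P * expR (- (c2 * n%:R)).
  rewrite exprMn -exprM -expRM_natl elnk.
  apply: (@le_trans _ _ (expR n%:R * (P * expR (k%:R * (n%:R * h1))) *
      expR (ln k%:R * (k.+1%:R * (A / k%:R ^+ 2 * n%:R))
       - (1 - k%:R^-1) * (k.+1%:R * ((A * n%:R - 1) * (1 - ebar)))))).
    rewrite ler_pM ?mulr_ge0 ?exprn_ge0 ?expR_ge0//.
      rewrite ler_pM ?mulr_ge0 ?exprn_ge0 ?expR_ge0//.
        rewrite -[n%:R]mulr1 expRM_natl lerXn2r ?nnegrE ?expR_ge0//.
        by apply: (le_trans _ (expR_ge1Dx 1)); lra.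
      by rewrite ler_wpM2r ?expR_ge0// n1P// leq_addr.
    rewrite ler_expR; apply: lerB.
      by rewrite ler_wpM2l ?(ltW lnk0)// ler_wpM2l.
    by rewrite ler_wpM2l// -mulrA ler_wpM2l// mulrA ler_wpM2r.
  rewrite [leLHS](_ : _ = P * expR (n%:R + k%:R * (n%:R * h1) +
      (ln k%:R * (k.+1%:R * (A / k%:R ^+ 2 * n%:R))
       - (1 - k%:R^-1) * (k.+1%:R * ((A * n%:R - 1) * (1 - ebar)))))); last first.
    by rewrite !expRD; ring.
  rewrite [leRHS](_ : _ = P * expR (k.+1%:R - c2 * n%:R)); last first.
    by rewrite expRD; ring.
  rewrite ler_wpM2l ?ler_expR//; first exact: le_trans P1.
  have ch := ler_wpM2r (ltW n0R) (adm_chain adm); move: ch; rewrite /= -/A => ch.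
  have c2n : c2 * n%:R <= c * n%:R by rewrite ler_wpM2r.
  have k1b : (1 - k%:R^-1) * (k.+1%:R * (1 - ebar)) <= k.+1%:R.
    apply: (@le_trans _ _ (1 * (k.+1%:R * 1))); last by rewrite mul1r mulr1.
    by rewrite ler_pM ?mulr_ge0// ?ler_wpM2l//; lra.
  have -> : (1 - k%:R^-1) * (k.+1%:R * ((A * n%:R - 1) * (1 - ebar))) =
      (1 - k%:R^-1) * (k.+1%:R * (A * (1 - ebar))) * n%:R
      - (1 - k%:R^-1) * (k.+1%:R * (1 - ebar)) by ring.
  move: ch; rewrite mulrBl !mulrDl mul1r mulNr => ch.
  have -> : k%:R * (n%:R * h1) = k%:R * h1 * n%:R by ring.
  have -> : ln k%:R * (k.+1%:R * (A / k%:R ^+ 2 * n%:R))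
      = ln k%:R * (k.+1%:R * (A / k%:R ^+ 2)) * n%:R by ring.
  lra.
have term3 : n.+1%:R ^+ (2 ^ k)%N * expR (n%:R * h0) *
     expR (ln k%:R * ((k%:R ^+ 2 * 2 ^+ k)^-1 * m%:R)
       - (1 - expR (- ln k%:R)) * (m%:R * 2^-1 ^+ k))
    <= expR 1 * P * expR (- (c2 * n%:R)).
  rewrite elnk.
  apply: (@le_trans _ _ (P * expR (n%:R * h0) *
      expR (ln k%:R * (A / k%:R ^+ 2 * n%:R) - (1 - k%:R^-1) * (A * n%:R - 1)))).
    rewrite ler_pM ?mulr_ge0 ?exprn_ge0 ?expR_ge0//.
      by rewrite ler_wpM2r ?expR_ge0// n1P// leq_addl.
    rewrite ler_expR; apply: lerB; first by rewrite ler_wpM2l ?(ltW lnk0).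
    by rewrite ler_wpM2l.
  rewrite -mulrA -expRD [leRHS](_ : _ = P * expR (1 - c2 * n%:R)); last first.
    by rewrite expRD; ring.
  rewrite ler_wpM2l ?ler_expR//; first exact: le_trans P1.
  have ch := ler_wpM2r (ltW n0R) (adm_clump adm); move: ch; rewrite /= -/A => ch.
  have c2n : c2 * n%:R <= c * n%:R by rewrite ler_wpM2r.
  have -> : (1 - k%:R^-1) * (A * n%:R - 1) =
      (1 - k%:R^-1) * A * n%:R - (1 - k%:R^-1) by ring.
  move: ch; rewrite mulrBl mulrDl mulNr => ch.
  have -> : n%:R * h0 = h0 * n%:R by ring.
  have -> : ln k%:R * (A / k%:R ^+ 2 * n%:R) = ln k%:R * (A / k%:R ^+ 2) * n%:R by ring.
  lra.
apply: (@le_trans _ _ (K * P * expR (- (c2 * n%:R)))).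
  have -> : K * P * expR (- (c2 * n%:R)) = t1 * r%:R * P * expR (- (c2 * n%:R))
      + t2 * (expR k.+1%:R * P * expR (- (c2 * n%:R)))
      + t3 * (expR 1 * P * expR (- (c2 * n%:R))) by rewrite /K; ring.
  by apply: lerD; [apply: lerD|] => //; rewrite ler_wpM2l.
apply: le_trans (ler_wpM2r (expR_ge0 _) (hN n nN)) _.
by rewrite -expRD ler_expR; lra.
Qed.

End Hardness.

(** * Derandomization *)

Section Derandomization.
Context (d : measure_display) (Omega : measurableType d) (R : realType).
Variables (P : probability Omega R) (k n m : nat) (f : rooted Omega -> bool).
Hypothesis mf : @measurable_alg d Omega k n m f.
Local Open Scope classical_set_scope.

Lemma measurable_event (Phi : formula k n m) (Q : assignment n -> Prop) :
  measurable [set t : sample Omega k n m | Q (local_alg f Phi t)].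
Proof.
rewrite (_ : [set t | _] = \bigcup_(z in [set z | Q z])
    \bigcap_(j in [set: 'I_n])
      ((fun t : sample Omega k n m => local_alg f Phi t j) @^-1` [set z j])).
  apply: fin_bigcup_measurable => [|z _]; first exact: finite_finset.
  apply: fin_bigcap_measurable => [|j _]; first exact: finite_finset.
  by rewrite -[X in measurable X]setTI; exact: (mf Phi j).
apply/seteqP; split=> t /=; first by move=> Qt; exists (local_alg f Phi t).
by move=> [z Qz h]; suff -> : local_alg f Phi t = z by []; apply/ffunP => j; exact: h.
Qed.

(** The finite sum over formulas is moved inside the integral over the randomness; a bound valid for
    every sample survives integration against a probability. *)
Lemma success_prob_le (Phi0 : formula k n m) (eta nu B : R) :
  (forall t : sample Omega k n m, avg (fun Phi : formula k n m =>
     `[< eta_nu_satisfies eta nu (local_alg f Phi t) Phi >]%:R) <= B) ->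
  (@success_prob d Omega R P k n m f eta nu <= B%:E)%E.
Proof.
move=> avgB; rewrite /success_prob.
set N := #|_|; set Q := power_prob P _.
pose S (Phi : formula k n m) : set (sample Omega k n m) :=
  [set t | eta_nu_satisfies eta nu (local_alg f Phi t) Phi].
have mS Phi : measurable (S Phi).
  exact: (@measurable_event Phi (fun z => eta_nu_satisfies eta nu z Phi)).
have NR : 0 < N%:R :> R by rewrite ltr0n; apply/card_gt0P; exists Phi0.
rewrite (eq_bigr (fun Phi => \int[Q]_(t in setT) (\1_(S Phi) t)%:E)%E); last first.
  by move=> Phi _; rewrite integral_indic// setIT.
rewrite -ge0_integral_sum//; last first.
  by move=> Phi; exact/measurable_EFinP/measurable_indic.
rewrite muleC lee_pdivrMr//.
apply: (@le_trans _ _ (\int[Q]_(t in setT) cst (B * N%:R)%:E t)%E); last first.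
  rewrite integral_cst//.
  rewrite [X in (_ * X)%E](_ : _ = 1%E) ?mule1//.
  exact: (@probability_setT _ _ _ Q).
apply: ge0_le_integral => //.
- by move=> t _; apply: sume_ge0.
- by apply: emeasurable_sum => Phi; exact/measurable_EFinP/measurable_indic.
move=> t _; rewrite /cst sumEFin lee_fin.
rewrite -ler_pdivrMr//; apply: le_trans (avgB t); apply: le_avg => Phi.
by rewrite indicE.
Qed.

End Derandomization.

Theorem theorem2p13 (R : realType) (kappa : R) (hkappa : kappa_star R < kappa) :
  exists (kst : nat) (c : R), (0 < kst)%N /\ 0 < c /\
  forall k : nat, (kst <= k)%N ->
  exists eta : R, c / k%:R ^+ 2 <= eta /\
  forall r : nat,
  exists (nst : nat) (C : R) (a : nat), (0 < nst)%N /\ 0 < C /\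
  forall n : nat, (nst <= n)%N ->
  let alpha : R := kappa * 2 ^+ k * ln k%:R / k%:R in
  let m : nat := Num.truncn (alpha * n%:R) in
  let nu : R := (k%:R ^+ 2 * 2 ^+ k)^-1 in
  forall (d : measure_display) (Omega : measurableType d)
         (P : probability Omega R) (f : rooted Omega -> bool),
  r_local r f ->
  @measurable_alg d Omega k n m f ->
  (@success_prob d Omega R P k n m f eta nu
     <= (expR (- (C * (n%:R `^ (3^-1)) / (ln n%:R) ^+ a)))%:E)%E.
Proof.
have [b b1 bkappa] := kappa_star_lt hkappa.
have kappa0 : 0 < kappa.
  have q1 : 0 < 1 - b * expR (- (b - 1)) by rewrite subr_gt0; exact: overlap_lt1.
  by rewrite -(pmulr_lgt0 _ q1); lra.
have [kst adm] := large_k b1 bkappa.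
exists (maxn 1 kst), 1; split; first by rewrite leq_max.
split=> // k.
rewrite geq_max => /andP[k1 /adm[h0 [h1 [T [mu [ebar [e [c admk]]]]]]]].
exists (k%:R ^+ 2)^-1; rewrite mul1r; split=> // r.
have [nst [C [C0 hard]]] := finite_hardness r kappa0 admk.
(* The bound e^(- C n) leaves room to take the logarithm to the power 0. *)
exists (maxn 1 nst), C, 0%N; split; first by rewrite leq_max.
split=> // n.
rewrite geq_max => /andP[n1 nn] alpha m nu d Omega P f floc fmeas.
rewrite expr0 divr1.
have Phi0 : formula k n m by exact: [tuple [tuple (Ordinal n1, true) | _ < k] | _ < m].
apply: (success_prob_le P fmeas Phi0) => t.
apply: (@le_trans _ _ (expR (- (C * n%:R)))); last first.
  rewrite ler_expR lerN2 ler_wpM2l ?(ltW C0)//.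
  rewrite -[leRHS]powRr1// ler_powR ?ler1n//; lra.
pose x (Phi : formula k n m) := local_alg f Phi t.
apply: (le_trans _ (hard n nn x _)).
  apply: le_avg => Phi; rewrite ler_nat; case: asboolP => // -[y xy /nu_satisfiesE ys].
  by rewrite lt0b; apply/existsP; exists y; rewrite /sat_near xy.
move=> Phi Phi' D j PhiE j1 j2; rewrite /x !ffunE.
exact: (local_stable (sample_at t) floc PhiE j1 j2).
Qed.
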